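(* For each integer $m>1$, each of the group manifolds $SU(m,m-1)$ and $(SL(2m-1,\mathbb{C}))^{\mathbb{R}}$ admits complex product structures which are compatible with the biinvariant pseudoriemannian metric induced by the Killing form of the respective real Lie algebra.
   Context: Let $M$ be a smooth manifold with tangent bundle $TM$. An almost product structure on $M$ is a smooth fibrewise linear involution $P:TM\to TM$ ($P^2=\mathrm{Id}$) of constant trace; it is a product structure if it is integrable, i.e. $N_P(X,Y)=[P(X),P(Y)]+[X,Y]-P([P(X),Y])-P([X,P(Y)])=0$ for all vector fields $X,Y$ on $M$. A complex structure is a smooth fibrewise linear $J:TM\to TM$ with $J^2=-\mathrm{Id}$ which is integrable, i.e. $N_J(X,Y)=[J(X),J(Y)]-[X,Y]-J([J(X),Y])-J([X,J(Y)])=0$ for all vector fields $X,Y$. A complex product structure on $M$ is a couple $(P,J)$ where $P$ is a product structure, $J$ is a complex structure, and $PJ=-JP$. A pseudoriemannian metric $g$ and a complex product structure $(P,J)$ on $M$ are compatible if $g(J(X),J(Y))=g(X,Y)$ and $g(P(X),P(Y))=-g(X,Y)$ for arbitrary tangent vectors $X,Y$ at a point of $M$. $SU(m,m-1)$ is the group of complex $(2m-1)\times(2m-1)$ matrices of determinant $1$ preserving a Hermitian form of signature $(m,m-1)$. $(SL(2m-1,\mathbb{C}))^{\mathbb{R}}$ denotes $SL(2m-1,\mathbb{C})$ regarded as a real Lie group, and the Killing form in question is that of its Lie algebra regarded as a real Lie algebra. *)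

(* Defs.v *)
From HB Require Import structures.
From mathcomp Require Import all_boot all_order all_algebra.
From mathcomp Require Import complex.
From mathcomp Require Import all_classical all_reals all_analysis.

Set Implicit Arguments.
Unset Strict Implicit.
Unset Printing Implicit Defensive.

Import Order.TTheory GRing.Theory Num.Theory.
Import numFieldNormedType.Exports.

Local Open Scope classical_set_scope.
Local Open Scope ring_scope.
Local Open Scope sesquilinear_scope.

(* Differential calculus on a subset S of a finite-dimensional real normed
   space V. When S is an embedded submanifold (in particular a matrix group),
   the notions below coincide with the intrinsic ones. *)
Section SmoothSubsets.
Context {R : realType}.

Fixpoint is_Ck {V W : normedModType R} (k : nat) (U : set V) (f : V -> W)
    : Prop :=
  match k with
  | 0 => forall x, U x -> {for x, continuous f}
  | k'.+1 => (forall x, U x -> differentiable f x) /\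
             (forall v, is_Ck k' U (fun x => 'D_v f x))
  end.

Definition smooth_open {V W : normedModType R} (U : set V) (f : V -> W) :=
  forall k, is_Ck k U f.

(* Smoothness on an arbitrary subset: existence of local smooth extensions. *)
Definition smooth_on {V W : normedModType R} (S : set V) (f : V -> W) :=
  forall x, S x -> exists (U : set V) (F : V -> W),
    [/\ open U, U x, smooth_open U F & forall y, U y -> S y -> f y = F y].

Context {V : normedModType R}.

Definition smooth_curve (S : set V) (x : V) (c : R -> V) :=
  c 0 = x /\
  exists I : set R,
    [/\ open I, I 0, smooth_open (V := R^o) I c & forall t, I t -> S (c t)].

Definition tangent (S : set V) (x v : V) :=
  exists2 c : R -> V, smooth_curve S x c & derive1 c 0 = v.

Definition tangent_bundle (S : set V) : set (V * V) :=
  [set p | S p.1 /\ tangent S p.1 p.2].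

(* Derivative at x, in the tangent direction v, of a function f that is smooth
   on S: the derivative at 0 of f along any curve in S with velocity v at x. *)
Definition derive_along {W : normedModType R} (S : set V) (f : V -> W)
    (x v : V) : W :=
  xget 0 [set w | exists c : R -> V,
    [/\ smooth_curve S x c, derive1 c 0 = v & w = derive1 (f \o c) 0]].

Definition vector_field (S : set V) (X : V -> V) :=
  (forall x, S x -> tangent S x (X x)) /\ smooth_on S X.

(* The bracket of vector fields of a submanifold, computed in the flat
   ambient space: [X, Y] = D_X Y - D_Y X. *)
Definition lie_bracket (S : set V) (X Y : V -> V) (x : V) : V :=
  derive_along S Y x (X x) - derive_along S X x (Y x).

(* P x v stands for the value of P at v in T_x S. *)
Definition smooth_endo (S : set V) (P : V -> V -> V) :=
  [/\ forall x v, S x -> tangent S x v -> tangent S x (P x v),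
      forall x a u v, S x -> tangent S x u -> tangent S x v ->
        P x (a *: u + v) = a *: P x u + P x v
    & smooth_on (tangent_bundle S) (fun p => P p.1 p.2)].

Definition app_endo (P : V -> V -> V) (X : V -> V) : V -> V :=
  fun x => P x (X x).

Definition complex_structure (S : set V) (J : V -> V -> V) :=
  [/\ smooth_endo S J,
      forall x v, S x -> tangent S x v -> J x (J x v) = - v
    & forall X Y, vector_field S X -> vector_field S Y -> forall x, S x ->
        lie_bracket S (app_endo J X) (app_endo J Y) x - lie_bracket S X Y x
        - J x (lie_bracket S (app_endo J X) Y x)
        - J x (lie_bracket S X (app_endo J Y) x) = 0].

End SmoothSubsets.

(* Trace of f restricted to U, for f linear on U and mapping U to itself. *)
Definition trace_on {F : fieldType} {vT : vectType F} (U : {vspace vT})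
    (f : vT -> vT) : F :=
  \sum_(i < \dim U) coord (vbasis U) i (f (vbasis U)`_i).

(* 'M[R[i]]_n as a real normed vector space: real and imaginary parts. *)
Notation rmat R n := ('M[R]_n * 'M[R]_n)%type.

Section MatrixGroups.
Context {R : realType} {n : nat}.
Implicit Types (x u v : rmat R n) (G : set 'M[R[i]]_n) (S : set (rmat R n)).

Definition to_cmx x : 'M[R[i]]_n := \matrix_(i, j) (x.1 i j +i* x.2 i j)%C.

Definition of_cmx (A : 'M[R[i]]_n) : rmat R n :=
  (\matrix_(i, j) complex.Re (A i j), \matrix_(i, j) complex.Im (A i j)).

Definition realify G : set (rmat R n) := [set x | G (to_cmx x)].

(* The subspace of all tangent vectors; 0 if these do not form a subspace
   (which cannot happen for a submanifold). *)
Definition tangent_space S x : {vspace rmat R n} :=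
  xget 0%VS [set U : {vspace rmat R n} | forall v, v \in U <-> tangent S x v].

Definition almost_product_structure S (P : rmat R n -> rmat R n -> rmat R n) :=
  [/\ smooth_endo S P,
      forall x v, S x -> tangent S x v -> P x (P x v) = v
    & exists c : R, forall x, S x -> trace_on (tangent_space S x) (P x) = c].

Definition product_structure S (P : rmat R n -> rmat R n -> rmat R n) :=
  almost_product_structure S P /\
  forall X Y, vector_field S X -> vector_field S Y -> forall x, S x ->
    lie_bracket S (app_endo P X) (app_endo P Y) x + lie_bracket S X Y x
    - P x (lie_bracket S (app_endo P X) Y x)
    - P x (lie_bracket S X (app_endo P Y) x) = 0.

Definition complex_product_structure S
    (P J : rmat R n -> rmat R n -> rmat R n) :=
  [/\ product_structure S P, complex_structure S J
    & forall x v, S x -> tangent S x v -> P x (J x v) = - J x (P x v)].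

Definition compatible S (g : rmat R n -> rmat R n -> rmat R n -> R)
    (P J : rmat R n -> rmat R n -> rmat R n) :=
  forall x u v, S x -> tangent S x u -> tangent S x v ->
    g x (J x u) (J x v) = g x u v /\ g x (P x u) (P x v) = - g x u v.

(* The Lie algebra of a matrix group G is its tangent space at the identity,
   a real vector space, with the commutator of complex matrices. *)
Definition lie_algebra G : {vspace rmat R n} :=
  tangent_space (realify G) (of_cmx 1%:M).

Definition commutator u v : rmat R n :=
  of_cmx (to_cmx u *m to_cmx v - to_cmx v *m to_cmx u).

Definition killing_form G u v : R :=
  trace_on (lie_algebra G) (fun w => commutator u (commutator v w)).

(* Left translation identifies T_x G with the Lie algebra; the Killing form
   being Ad-invariant, the result is also right-invariant. *)
Definition killing_metric G x u v : R :=
  killing_form G (of_cmx (invmx (to_cmx x) *m to_cmx u))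
                 (of_cmx (invmx (to_cmx x) *m to_cmx v)).

Definition SL_group : set 'M[R[i]]_n := [set A | \det A = 1].

Definition SU_group (H : 'M[R[i]]_n) : set 'M[R[i]]_n :=
  [set A | A ^t* *m H *m A = H /\ \det A = 1].

Definition admits_killing_compatible_cps G :=
  exists P J : rmat R n -> rmat R n -> rmat R n,
    complex_product_structure (realify G) P J /\
    compatible (realify G) (killing_metric G) P J.

End MatrixGroups.

Arguments SL_group R n : clear implicits.

(* H is the Gram matrix of a Hermitian form of signature (p, q): in a suitable
   basis the form is diagonal with p entries 1 and q entries -1. *)
Definition hermitian_signature {R : realType} (p q : nat)
    (H : 'M[R[i]]_(p + q)) :=
  exists2 Q : 'M[R[i]]_(p + q), Q \in unitmx
    & H = Q ^t* *m block_mx 1%:M 0 0 (- 1%:M) *m Q.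

(* Main.v *)
Require Import Defs.
From HB Require Import structures.
From mathcomp Require Import all_boot all_order all_algebra fingroup perm.
From mathcomp Require Import complex spectral ring.
From mathcomp Require Import all_classical all_reals all_analysis.

(** Left translation turns everything into algebra on the Lie algebra: a
complex-linear endomorphism A of sl(n, C) gives the endomorphism
v |-> x A(x^-1 v) of T_x G, whose Nijenhuis tensor is the algebraic one of A.

The Lie algebra endomorphisms J and P (with J^2 = -1, P^2 = 1, PJ = -JP) are
built by going from n to n + 2, in the way Joyce found invariant hypercomplex
structures on compact groups. Cut matrices of size 2 + N into blocks. The
traceless block-diagonal matrices split as sl(N) + sl(2) + C e, where e is a
scalar on each of the two blocks; replacing e by the 2x2 identity matrix
identifies sl(2) + C e with all 2x2 matrices. A 2x2 traceless matrix s with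
s^2 = eps then acts on that part by left multiplication, on the off-diagonal
blocks by the adjoint action, and on sl(N) through the structure already
constructed. For a suitable length of e the trace form on sl(2) + C e is a
multiple of the polarized determinant, so s multiplies it by det s = - eps.
With s in su(1, 1) the construction preserves su(m, m-1). Finally the Killing
form is a multiple of Re tr(XY). *)

Set Implicit Arguments.
Unset Strict Implicit.
Unset Printing Implicit Defensive.

Import Order.TTheory GRing.Theory Num.Theory.
Import numFieldNormedType.Exports.

Local Open Scope classical_set_scope.
Local Open Scope ring_scope.
Local Open Scope sesquilinear_scope.

(** * Endomorphisms of sl(n, C) *)

(** The metric dictates e. Under the polarization of - 2 det the identity matrix has square length -
    2, so e must satisfy tr (e ^+ 2) = - 2. This makes w purely imaginary, which is also what puts e
    in the real form: an element of su(m, m-1) then has a real coefficient along e, and its 2x2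
    coordinate is a split quaternion. Split quaternions are closed under products, so left
    multiplication by s preserves the real form.

    Integrability is checked on the bilinear terms b of the bracket one at a time. Apart from the
    bracket of sl(N) and a trace correction in the 2x2 part, each satisfies b(Sx, y) = S b(x, y), or
    the same in y, or b(Sx, y) = - b(x, Sy). As S^2 = eps, any of these makes b(Sx, Sy) + eps b(x,
    y) - S b(Sx, y) - S b(x, Sy) vanish.

    The induction starts from sl(1) = 0 and each step adds a plane of signature (1, 1); this
    accounts for the odd size and the signature (m, m-1). The operators are complex-linear on sl(n,
    C), so SL and SU share them. The trace of P is constant because P anticommutes with J, which
    makes it 0. *)

Section MatrixEntries.
Context {R : pzRingType} {m n : nat}.
Implicit Types A B : 'M[R]_(m, n).
Lemma addmx_entry A B i j : (A + B) i j = A i j + B i j. Proof. exact: mxE. Qed.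
Lemma oppmx_entry A i j : (- A) i j = - A i j. Proof. exact: mxE. Qed.
Lemma scalemx_entry k A i j : (k *: A) i j = k * A i j. Proof. exact: mxE. Qed.
Lemma zeromx_entry i j : (0 : 'M[R]_(m, n)) i j = 0. Proof. exact: mxE. Qed.
End MatrixEntries.

Definition mx_entries := (@addmx_entry, @oppmx_entry, @scalemx_entry, @zeromx_entry).

Ltac mx_ring := apply/matrixP => ? ?; rewrite !mx_entries; ring.

Definition mxbr {R : pzRingType} {n} (A B : 'M[R]_n) : 'M[R]_n :=
  A *m B - B *m A.

Lemma mxtraceN {R : pzRingType} n (A : 'M[R]_n) : \tr (- A) = - \tr A.
Proof. exact: raddfN. Qed.

Lemma mxtraceB {R : pzRingType} n (A B : 'M[R]_n) : \tr (A - B) = \tr A - \tr B.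
Proof. exact: raddfB. Qed.

Section ConjugateTranspose.
Context {C : numClosedFieldType}.

Lemma ctmxM m n p (A : 'M[C]_(m, n)) (B : 'M[C]_(n, p)) :
  (A *m B) ^t* = B ^t* *m A ^t*.
Proof. by rewrite trmx_mul map_mxM. Qed.

Lemma ctmxD m n (A B : 'M[C]_(m, n)) : (A + B) ^t* = A ^t* + B ^t*.
Proof. by rewrite linearD map_mxD. Qed.

Lemma ctmxN m n (A : 'M[C]_(m, n)) : (- A) ^t* = - A ^t*.
Proof. by rewrite linearN map_mxN. Qed.

Lemma ctmxZ m n k (A : 'M[C]_(m, n)) : (k *: A) ^t* = k^* *: A ^t*.
Proof. by rewrite linearZ map_mxZ. Qed.

Lemma ctmx1 n : (1%:M : 'M[C]_n) ^t* = 1%:M.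
Proof. by rewrite trmx1 map_mx1. Qed.

Lemma mxtrace_ctmx n (A : 'M[C]_n) : \tr (A ^t*) = (\tr A)^*.
Proof. by rewrite trace_map_mx mxtrace_tr. Qed.

Lemma ctmx_block m1 m2 n1 n2 (A : 'M[C]_(m1, n1)) (B : 'M[C]_(m1, n2))
    (E : 'M[C]_(m2, n1)) (D : 'M[C]_(m2, n2)) :
  (block_mx A B E D) ^t* = block_mx (A ^t*) (E ^t*) (B ^t*) (D ^t*).
Proof. by rewrite tr_block_mx map_block_mx. Qed.
End ConjugateTranspose.

Section InvariantStructures.
Context {C : numClosedFieldType}.

Definition skew_hermitian n (H X : 'M[C]_n) := X ^t* *m H + H *m X = 0.

Definition mx_linear n (S : 'M[C]_n -> 'M[C]_n) :=
  forall (k : C) (X Y : 'M[C]_n), S (k *: X + Y) = k *: S X + S Y.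

(** The sign eps is - 1 for J and 1 for P, so that [sls_form] makes J an isometry and P an
    anti-isometry. S is defined on all matrices but constrained on the traceless ones; the last
    field lets it restrict to the real form given by H. *)
Record sl_structure n (H : 'M[C]_n) (eps : C) (S : 'M[C]_n -> 'M[C]_n) : Prop :=
  SlStructure {
  sls_linear : mx_linear S;
  sls_trace : forall X, \tr X = 0 -> \tr (S X) = 0;
  sls_square : forall X, \tr X = 0 -> S (S X) = eps *: X;
  sls_nijenhuis : forall X Y, \tr X = 0 -> \tr Y = 0 ->
    mxbr (S X) (S Y) + eps *: mxbr X Y - S (mxbr (S X) Y) - S (mxbr X (S Y)) = 0;
  sls_form : forall X Y, \tr X = 0 -> \tr Y = 0 ->
    \tr (S X *m S Y) = - eps * \tr (X *m Y);
  sls_skew : forall X, \tr X = 0 -> skew_hermitian H X -> skew_hermitian H (S X)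
}.

Definition sl_structure_pair n (H : 'M[C]_n) :=
  exists J P, [/\ sl_structure H (- 1) J, sl_structure H 1 P
    & forall X, \tr X = 0 -> P (J X) = - J (P X)].

(* The element e is diag(w, w, - 2 w / N, ..., - 2 w / N); the value of w ^+ 2
   gives tr (e ^+ 2) = - 2, the same as for diag('i, - 'i). *)
Section Extension.
Variables (N : nat) (w : C).
Hypothesis N_gt0 : (0 < N)%N.
Hypothesis w_sqr : w ^+ 2 = - (N%:R / N.+2%:R).

Let N_neq0 : N%:R != 0 :> C. Proof. by rewrite pnatr_eq0 -lt0n. Qed.
Let w_neq0 : w != 0.
Proof.
apply/eqP => w0; move/eqP: w_sqr; rewrite w0 expr0n /= eq_sym oppr_eq0.
by rewrite mulf_eq0 invr_eq0 !pnatr_eq0 (gtn_eqF N_gt0).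
Qed.

(** If t is the coefficient of e, the upper left corner has scalar part t w; here it is rescaled to
    t. *)
Definition quat (A : 'M[C]_2) : 'M[C]_2 := A + ((w^-1 - 1) / 2 * \tr A) *: 1%:M.
Definition detrace (D : 'M[C]_N) : 'M[C]_N := D - (\tr D / N%:R) *: 1%:M.

(** The inverse coordinates: the scalar part [\tr a / 2] of a becomes the coefficient of e, whose
    blocks are w and - 2 w / N. *)
Definition assemble (a : 'M[C]_2) (B : 'M[C]_(2, N)) (E : 'M[C]_(N, 2))
    (D : 'M[C]_N) : 'M[C]_(2 + N) :=
  block_mx (a + ((w - 1) / 2 * \tr a) *: 1%:M) B E (D - (w / N%:R * \tr a) *: 1%:M).

Definition extension (s : 'M[C]_2) (S : 'M[C]_N -> 'M[C]_N)
    (X : 'M[C]_(2 + N)) : 'M[C]_(2 + N) :=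
  assemble (s *m quat (ulsubmx X)) (s *m ursubmx X) (- (dlsubmx X *m s))
    (S (detrace (drsubmx X))).

Lemma quat_linear k X Y : quat (k *: X + Y) = k *: quat X + quat Y.
Proof. rewrite /quat linearP /=; mx_ring. Qed.

Lemma detrace_linear k X Y : detrace (k *: X + Y) = k *: detrace X + detrace Y.
Proof. rewrite /detrace linearP /=; mx_ring. Qed.

Lemma mxtrace_detrace D : \tr (detrace D) = 0.
Proof. by rewrite /detrace raddfB /= mxtraceZ mxtrace1 divfK ?subrr. Qed.

Lemma detrace_id D : \tr D = 0 -> detrace D = D.
Proof. by rewrite /detrace => ->; rewrite mul0r scale0r subr0. Qed.

Lemma assemble_linear k a B E D a' B' E' D' :
  k *: assemble a B E D + assemble a' B' E' D' =
  assemble (k *: a + a') (k *: B + B') (k *: E + E') (k *: D + D').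
Proof.
rewrite /assemble scale_block_mx add_block_mx linearP /=.
congr block_mx; mx_ring.
Qed.

Lemma mxtrace_assemble a B E D : \tr (assemble a B E D) = \tr D.
Proof.
rewrite mxtrace_block !(mxtraceD, mxtraceZ, raddfN) /= mxtraceZ !mxtrace1.
by field; rewrite N_neq0.
Qed.

Lemma quat_assemble a B E D : quat (ulsubmx (assemble a B E D)) = a.
Proof.
rewrite block_mxKul /quat mxtraceD mxtraceZ mxtrace1.
apply/matrixP => i j; rewrite !mx_entries; field; exact: w_neq0.
Qed.

Lemma detrace_assemble a B E D : \tr D = 0 ->
  detrace (drsubmx (assemble a B E D)) = D.
Proof.
move=> D0; rewrite block_mxKdr /detrace raddfB /= mxtraceZ mxtrace1 D0.
apply/matrixP => i j; rewrite !mx_entries; field; exact: N_neq0.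
Qed.

Lemma assemble_surj X : \tr X = 0 ->
  X = assemble (quat (ulsubmx X)) (ursubmx X) (dlsubmx X) (detrace (drsubmx X)).
Proof.
move=> X0; rewrite -[LHS]submxK.
have trX : \tr (drsubmx X) = - \tr (ulsubmx X).
  apply/eqP; rewrite -addr_eq0 addrC; apply/eqP.
  rewrite -(mxtrace_block _ (ursubmx X) (dlsubmx X)); by rewrite submxK.
rewrite /assemble; congr block_mx.
  rewrite /quat mxtraceD mxtraceZ mxtrace1.
  apply/matrixP => i j; rewrite !mx_entries; field; exact: w_neq0.
rewrite /quat /detrace mxtraceD mxtraceZ mxtrace1 trX.
apply/matrixP => i j; rewrite !mx_entries; field; by rewrite w_neq0 N_neq0.
Qed.

(* In these coordinates the trace form splits off the polarization of
   [-2 det] on the 2x2 part. *)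
Lemma mxtrace_assemble_mul a B E D a' B' E' D' : \tr D = 0 -> \tr D' = 0 ->
  \tr (assemble a B E D *m assemble a' B' E' D') =
  \tr (a *m a') - \tr a * \tr a' + \tr (B *m E') + \tr (E *m B') + \tr (D *m D').
Proof.
move=> D0 D0'; rewrite mulmx_block mxtrace_block.
rewrite !(mulmxDl, mulmxDr, mulmxN, mulNmx, =^~ scalemxAl, =^~ scalemxAr, mulmx1, mul1mx).
rewrite !(mxtraceD, mxtraceZ, raddfN) /= !(mxtraceD, mxtraceZ, raddfN) /= !mxtrace1 D0 D0'.
(* The two sides differ only in the coefficient of [\tr a * \tr a'], by a multiple of this
   expression; this is where the length of e enters. *)
have wN : w * w * (N%:R + 2) + N%:R = 0.
  rewrite -natrD addn2 -expr2 w_sqr mulNr divfK ?pnatr_eq0 //.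
  by rewrite addNr.
apply/eqP; rewrite -subr_eq0; apply/eqP.
transitivity (\tr a * \tr a' / (2 * N%:R) * (w * w * (N%:R + 2) + N%:R)); last first.
  by rewrite wN mulr0.
by field; rewrite N_neq0.
Qed.

Lemma mxtrace2 (x : 'M[C]_2) : \tr x = x 0 0 + x 1 1.
Proof. by rewrite /mxtrace !big_ord_recl big_ord0 addr0 //=; congr (_ + x _ _); apply: val_inj. Qed.

Lemma mulmx2E (x y : 'M[C]_2) i j : (x *m y) i j = x i 0 * y 0 j + x i 1 * y 1 j.
Proof.
rewrite mxE !big_ord_recl big_ord0 addr0 //=.
by congr (_ + x _ _ * y _ _); apply: val_inj.
Qed.

Lemma matrix2P (x y : 'M[C]_2) :
  x 0 0 = y 0 0 -> x 0 1 = y 0 1 -> x 1 0 = y 1 0 -> x 1 1 = y 1 1 -> x = y.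
Proof.
move=> h00 h01 h10 h11; apply/matrixP => i j.
have ord2 (k : 'I_2) : k = 0 \/ k = 1.
  by case: k => [[|[|//]] ?]; [left|right]; apply: val_inj.
by case: (ord2 i) => ->; case: (ord2 j) => ->.
Qed.

Definition bracket_quat (a : 'M[C]_2) (B : 'M[C]_(2, N)) (E : 'M[C]_(N, 2))
    (a' : 'M[C]_2) (B' : 'M[C]_(2, N)) (E' : 'M[C]_(N, 2)) :=
  mxbr a a' + quat (B *m E' - B' *m E).

(** On row blocks ad e is multiplication by w + 2 w / N, whereas the product with a already lets its
    scalar part act with factor 1. The last term is the difference. *)
Definition bracket_row (a : 'M[C]_2) (B : 'M[C]_(2, N)) (D : 'M[C]_N)
    (a' : 'M[C]_2) (B' : 'M[C]_(2, N)) (D' : 'M[C]_N) :=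
  a *m B' + B *m D' - a' *m B - B' *m D
  + ((w - 1) / 2 + w / N%:R) *: (\tr a *: B' - \tr a' *: B).

Definition bracket_col (a : 'M[C]_2) (E : 'M[C]_(N, 2)) (D : 'M[C]_N)
    (a' : 'M[C]_2) (E' : 'M[C]_(N, 2)) (D' : 'M[C]_N) :=
  E *m a' + D *m E' - E' *m a - D' *m E
  - ((w - 1) / 2 + w / N%:R) *: (\tr a *: E' - \tr a' *: E).

Definition bracket_corner (B : 'M[C]_(2, N)) (E : 'M[C]_(N, 2)) (D : 'M[C]_N)
    (B' : 'M[C]_(2, N)) (E' : 'M[C]_(N, 2)) (D' : 'M[C]_N) :=
  mxbr D D' + detrace (E *m B' - E' *m B).

Lemma mxtrace_mxbr k (x y : 'M[C]_k) : \tr (mxbr x y) = 0.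
Proof. by rewrite /mxbr raddfB /= mxtrace_mulC subrr. Qed.

Lemma mxbr_assemble a B E D a' B' E' D' :
  mxbr (assemble a B E D) (assemble a' B' E' D') =
  assemble (bracket_quat a B E a' B' E') (bracket_row a B D a' B' D')
    (bracket_col a E D a' E' D') (bracket_corner B E D B' E' D').
Proof.
rewrite /mxbr !mulmx_block opp_block_mx add_block_mx.
rewrite [RHS]/assemble /bracket_quat mxtraceD mxtrace_mxbr add0r.
rewrite /quat mxtraceD mxtraceZ mxtrace1 /bracket_corner /detrace /mxbr.
have -> : \tr (E *m B' - E' *m B) = - \tr (B *m E' - B' *m E).
  by rewrite !raddfB /= ![\tr (E *m _)]mxtrace_mulC ![\tr (E' *m _)]mxtrace_mulC; ring.
set z := \tr (B *m E' - B' *m E).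
rewrite !(mulmxDl, mulmxDr, mulmxBl, mulmxBr, mulmxN, mulNmx).
rewrite -!(scalemxAl, scalemxAr) !(mulmx1, mul1mx).
rewrite /bracket_row /bracket_col.
congr block_mx; apply/matrixP => i j; rewrite !mx_entries; field;
  by rewrite ?w_neq0 ?N_neq0.
Qed.

Section Step.
Variables (HN : 'M[C]_N) (h s : 'M[C]_2) (eps : C) (S : 'M[C]_N -> 'M[C]_N).
Hypothesis SP : sl_structure HN eps S.
Hypothesis s_tr : \tr s = 0.
Hypothesis s_sqr : s *m s = eps%:M.

Let mulss k (x : 'M[C]_(k, 2)) : x *m s *m s = eps *: x.
Proof. by rewrite -mulmxA s_sqr mul_mx_scalar. Qed.
Let ssmul k (x : 'M[C]_(2, k)) : s *m s *m x = eps *: x.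
Proof. by rewrite s_sqr mul_scalar_mx. Qed.

Lemma extension_assemble a B E D : \tr D = 0 ->
  extension s S (assemble a B E D) = assemble (s *m a) (s *m B) (- (E *m s)) (S D).
Proof.
move=> D0; rewrite /extension quat_assemble detrace_assemble //.
by rewrite block_mxKur block_mxKdl.
Qed.

Lemma extension_linear k X Y :
  extension s S (k *: X + Y) = k *: extension s S X + extension s S Y.
Proof.
rewrite /extension assemble_linear.
have -> : ulsubmx (k *: X + Y) = k *: ulsubmx X + ulsubmx Y by apply/matrixP => i j; rewrite !mxE.
have -> : ursubmx (k *: X + Y) = k *: ursubmx X + ursubmx Y by apply/matrixP => i j; rewrite !mxE.
have -> : dlsubmx (k *: X + Y) = k *: dlsubmx X + dlsubmx Y by apply/matrixP => i j; rewrite !mxE.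
have -> : drsubmx (k *: X + Y) = k *: drsubmx X + drsubmx Y by apply/matrixP => i j; rewrite !mxE.
rewrite quat_linear detrace_linear (sls_linear SP).
rewrite [s *m (_ *: quat _ + _)]mulmxDr [s *m (_ *: ursubmx _ + _)]mulmxDr [(_ + _) *m s]mulmxDl.
rewrite -[s *m (k *: quat _)]scalemxAr -[s *m (k *: ursubmx _)]scalemxAr -scalemxAl.
by rewrite opprD scalerN.
Qed.

Lemma mxtrace_extension X : \tr (extension s S X) = 0.
Proof. by rewrite mxtrace_assemble (sls_trace SP) // mxtrace_detrace. Qed.

Lemma assemble0 : assemble 0 0 0 0 = 0.
Proof.
by rewrite /assemble raddf0 !(mulr0, scale0r, subr0, addr0) block_mx0.
Qed.

Lemma assembleZ k a B E D :
  k *: assemble a B E D = assemble (k *: a) (k *: B) (k *: E) (k *: D).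
Proof. by have := assemble_linear k a B E D 0 0 0 0; rewrite assemble0 !addr0. Qed.

Lemma assembleD a B E D a' B' E' D' :
  assemble a B E D + assemble a' B' E' D' = assemble (a + a') (B + B') (E + E') (D + D').
Proof. by rewrite -[X in X + _]scale1r assemble_linear !scale1r. Qed.

Lemma assembleB a B E D a' B' E' D' :
  assemble a B E D - assemble a' B' E' D' = assemble (a - a') (B - B') (E - E') (D - D').
Proof. by rewrite -[in X in _ + X]scaleN1r assembleZ assembleD !scaleN1r. Qed.

Lemma extension_square X : \tr X = 0 ->
  extension s S (extension s S X) = eps *: X.
Proof.
move=> X0; rewrite (assemble_surj X0) !extension_assemble ?mxtrace_detrace //;
  last by rewrite (sls_trace SP) // mxtrace_detrace.
rewrite (sls_square SP) ?mxtrace_detrace // !mulmxA !ssmul mulNmx mulss opprK.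
by rewrite assembleZ.
Qed.

Lemma detraceB x y : detrace (x - y) = detrace x - detrace y.
Proof. by rewrite -[in LHS]scaleN1r addrC detrace_linear scaleN1r addrC. Qed.

Lemma mxtrace_corner B E D B' E' D' : \tr (bracket_corner B E D B' E' D') = 0.
Proof. by rewrite mxtraceD mxtrace_mxbr mxtrace_detrace addr0. Qed.

(** The commutator of a and a' cancels because s can be pulled out of a left factor. For x = B E'
    the matrix part cancels too, and so does the trace part of [quat], since tr (s x s) = eps tr x
    and tr (x s) = tr (s x). *)
Lemma quat_nijenhuis a B E a' B' E' :
  bracket_quat (s *m a) (s *m B) (- (E *m s)) (s *m a') (s *m B') (- (E' *m s))
  + eps *: bracket_quat a B E a' B' E'
  - s *m bracket_quat (s *m a) (s *m B) (- (E *m s)) a' B' E'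
  - s *m bracket_quat a B E (s *m a') (s *m B') (- (E' *m s)) = 0.
Proof.
rewrite /bracket_quat /quat /mxbr.
rewrite !(mulmxN, mulNmx, mulmxA, mulmxDr, mulmxDl, mulmxBr, mulmxBl).
rewrite !(mxtraceB, mxtraceD, mxtraceN).
rewrite -!(scalemxAl, scalemxAr) !(mulmx1, mul1mx) !ssmul.
rewrite -!(scalemxAl, scalemxAr).
have trs (x : 'M[C]_(2, N)) (y : 'M[C]_(N, 2)) : \tr (s *m x *m y *m s) = eps * \tr (x *m y).
  by rewrite mxtrace_mulC !mulmxA ssmul -scalemxAl mxtraceZ.
rewrite !trs [\tr (B *m E' *m s)]mxtrace_mulC [\tr (B' *m E *m s)]mxtrace_mulC !mulmxA.
apply/matrixP => i j; rewrite !mx_entries; ring.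
Qed.

(** In every product s comes out on the left of the first factor, and in the trace terms it comes
    out of B or B'. Each term therefore cancels separately, whatever S does to D and D'. *)
Lemma row_nijenhuis a B D a' B' D' :
  bracket_row (s *m a) (s *m B) (S D) (s *m a') (s *m B') (S D')
  + eps *: bracket_row a B D a' B' D'
  - s *m bracket_row (s *m a) (s *m B) (S D) a' B' D'
  - s *m bracket_row a B D (s *m a') (s *m B') (S D') = 0.
Proof.
rewrite /bracket_row.
rewrite !(mulmxN, mulNmx, mulmxA, mulmxDr, mulmxDl, mulmxBr, mulmxBl).
rewrite -!(scalemxAl, scalemxAr) !(mulmxBr, mulmxA) -!(scalemxAl, scalemxAr) !mulmxA !ssmul.
rewrite -!(scalemxAl, scalemxAr).
apply/matrixP => i j; rewrite !mx_entries; ring.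
Qed.

(** In E a' the factor s sits between the two matrices, so moving it from E to a' only changes the
    sign. The terms with D or a trace commute with right multiplication by s. *)
Lemma col_nijenhuis a E D a' E' D' :
  bracket_col (s *m a) (- (E *m s)) (S D) (s *m a') (- (E' *m s)) (S D')
  + eps *: bracket_col a E D a' E' D'
  + bracket_col (s *m a) (- (E *m s)) (S D) a' E' D' *m s
  + bracket_col a E D (s *m a') (- (E' *m s)) (S D') *m s = 0.
Proof.
rewrite /bracket_col.
rewrite !(mulmxN, mulNmx, mulmxA, mulmxDr, mulmxDl, mulmxBr, mulmxBl).
rewrite -!(scalemxAl, scalemxAr) !(mulmxBl, mulmxA, mulNmx) -!(scalemxAl, scalemxAr) !mulNmx !mulss.
rewrite -!(scalemxAl, scalemxAr).
apply/matrixP => i j; rewrite !mx_entries; ring.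
Qed.

(** Since (- E s) B' = - E (s B'), the off-diagonal products contribute opposite arguments to the
    two values of S, and their remaining terms cancel by s^2 = eps. What is left is the Nijenhuis
    identity of S on sl(N). *)
Lemma corner_nijenhuis B E D B' E' D' : \tr D = 0 -> \tr D' = 0 ->
  bracket_corner (s *m B) (- (E *m s)) (S D) (s *m B') (- (E' *m s)) (S D')
  + eps *: bracket_corner B E D B' E' D'
  - S (bracket_corner (s *m B) (- (E *m s)) (S D) B' E' D')
  - S (bracket_corner B E D (s *m B') (- (E' *m s)) (S D')) = 0.
Proof.
move=> D0 D0'.
have SD x y : S (x + y) = S x + S y.
  by rewrite -[in LHS](scale1r x) (sls_linear SP) scale1r.
have S0 : S 0 = 0 by apply: (addrI (S 0)); rewrite -SD !addr0.
have := sls_nijenhuis SP D0 D0'; rewrite /bracket_corner.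
rewrite (SD (mxbr (S D) D')) (SD (mxbr D (S D'))).
rewrite !(mulNmx, mulmxN, mulmxA) !mulss -!scalemxAl.
set u := mxbr (S D) (S D'); set v := mxbr D D'; set x := S (mxbr _ _); set y := S (mxbr _ _).
set z1 := detrace (- _ - _); set z2 := detrace (_ - _); set z3 := detrace _; set z4 := detrace _.
have z43 : S z3 = - S z4.
  have -> : z3 = (-1) *: z4 + 0.
    rewrite addr0 scaleN1r /z3 /z4 -[- detrace _]sub0r.
    by rewrite -{1}(detrace_id (mxtrace0 _ _)) -detraceB; congr detrace; mx_ring.
  by rewrite (sls_linear SP) S0 addr0 scaleN1r.
have z12 : z1 = - eps *: z2.
  rewrite -[RHS]addr0 -(detrace_id (mxtrace0 _ _)) -detrace_linear; congr detrace; mx_ring.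
move=> H; rewrite -[RHS]H z12 z43; mx_ring.
Qed.

Lemma extension_nijenhuis X Y : \tr X = 0 -> \tr Y = 0 ->
  mxbr (extension s S X) (extension s S Y) + eps *: mxbr X Y
  - extension s S (mxbr (extension s S X) Y)
  - extension s S (mxbr X (extension s S Y)) = 0.
Proof.
move=> X0 Y0; rewrite (assemble_surj X0) (assemble_surj Y0).
move: (mxtrace_detrace (drsubmx X)) (mxtrace_detrace (drsubmx Y)).
move: (quat _) (ursubmx _) (dlsubmx _) (detrace _) => a B E D.
move: (quat _) (ursubmx _) (dlsubmx _) (detrace _) => a' B' E' D' D0 D0'.
rewrite (extension_assemble _ _ _ D0) (extension_assemble _ _ _ D0').
have bracketE a1 B1 E1 D1 a2 B2 E2 D2 :
    extension s S (mxbr (assemble a1 B1 E1 D1) (assemble a2 B2 E2 D2)) =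
    assemble (s *m bracket_quat a1 B1 E1 a2 B2 E2) (s *m bracket_row a1 B1 D1 a2 B2 D2)
      (- (bracket_col a1 E1 D1 a2 E2 D2 *m s)) (S (bracket_corner B1 E1 D1 B2 E2 D2)).
  by rewrite mxbr_assemble extension_assemble // mxtrace_corner.
rewrite [X in _ - X - _]bracketE [X in _ - X]bracketE.
rewrite [X in X + _ - _ - _]mxbr_assemble [X in _ + _ *: X - _ - _]mxbr_assemble.
rewrite assembleZ assembleD !assembleB !opprK.
rewrite quat_nijenhuis row_nijenhuis col_nijenhuis corner_nijenhuis ?mxtrace_detrace //.
exact: assemble0.
Qed.

Lemma quat_form (a a' : 'M[C]_2) :
  \tr ((s *m a) *m (s *m a')) - \tr (s *m a) * \tr (s *m a') =
  - eps * (\tr (a *m a') - \tr a * \tr a').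
Proof.
have s11 : s 1 1 = - s 0 0.
  by apply/eqP; rewrite -addr_eq0 addrC -mxtrace2 s_tr.
have -> : eps = s 0 0 * s 0 0 + s 0 1 * s 1 0.
  by rewrite -mulmx2E s_sqr !mxE.
rewrite !mxtrace2 !mulmx2E s11; ring.
Qed.

Lemma extension_form X Y : \tr X = 0 -> \tr Y = 0 ->
  \tr (extension s S X *m extension s S Y) = - eps * \tr (X *m Y).
Proof.
move=> X0 Y0; rewrite (assemble_surj X0) (assemble_surj Y0).
rewrite !extension_assemble ?mxtrace_detrace //.
rewrite !mxtrace_assemble_mul ?(sls_trace SP) ?mxtrace_detrace //.
rewrite quat_form (sls_form SP) ?mxtrace_detrace //.
rewrite !mulmxN !mulNmx !mulmxA !mulss -scalemxAl !mxtraceN mxtraceZ.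
rewrite [\tr (s *m _ *m _ *m s)]mxtrace_mulC !mulmxA ssmul -scalemxAl mxtraceZ; ring.
Qed.

Hypothesis h_ct : h ^t* = h.
Hypothesis h_sqr : h *m h = 1%:M.
Hypothesis w_conj : w^* = - w.

(* The elements t + x with t real and x in su(1, 1) form a copy of the split
   quaternions, which the next predicate describes by the adjugate. *)
Definition split_quaternion (a : 'M[C]_2) := h *m a ^t* *m h = (\tr a)%:M - a.

Hypothesis s_quat : split_quaternion s.

Let hhmul k (x : 'M[C]_(2, k)) : h *m (h *m x) = x.
Proof. by rewrite mulmxA h_sqr mul1mx. Qed.

(** Both sides of the defining equation reverse products: the map a |-> h a^* h because h^2 = 1, and
    the adjugate because it is one. *)
Lemma split_quaternionM a b :
  split_quaternion a -> split_quaternion b -> split_quaternion (a *m b).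
Proof.
rewrite /split_quaternion => aq bq.
have -> : h *m (a *m b) ^t* *m h = (h *m b ^t* *m h) *m (h *m a ^t* *m h).
  by rewrite ctmxM -!mulmxA hhmul.
rewrite aq bq; apply: matrix2P; rewrite !(mulmx2E, mxtrace2, mxE, mx_entries) /=;
  rewrite ?mulr1n ?mulr0n; ring.
Qed.

Lemma split_quaternion_trace a : split_quaternion a -> (\tr a)^* = \tr a.
Proof.
move=> /(congr1 mxtrace); rewrite mxtrace_mulC mulmxA h_sqr mul1mx mxtrace_ctmx => ->.
by rewrite mxtraceB mxtrace_scalar; ring.
Qed.

Lemma skew_block A B E D : skew_hermitian (block_mx h 0 0 HN) (block_mx A B E D) <->
  [/\ A ^t* *m h + h *m A = 0, E ^t* *m HN + h *m B = 0,
      B ^t* *m h + HN *m E = 0 & D ^t* *m HN + HN *m D = 0].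
Proof.
rewrite /skew_hermitian ctmx_block !mulmx_block !(mulmx0, mul0mx, addr0, add0r) add_block_mx.
split=> [H|[-> -> -> ->]]; last exact: block_mx0.
by have := H; rewrite -(block_mx0 C 2 N 2 N) => /eq_block_mx.
Qed.

Lemma skew_trace A : A ^t* *m h + h *m A = 0 -> (\tr A)^* = - \tr A.
Proof.
move/eqP; rewrite addr_eq0 => /eqP /(congr1 (fun x => \tr (h *m x))).
rewrite mulmxN hhmul mulmxA mxtrace_mulC mulmxA h_sqr mul1mx mxtrace_ctmx => ->.
exact: mxtraceN.
Qed.

(** A skew corner has imaginary trace, and [quat] divides the trace by the imaginary number w; the
    result has the real trace that a split quaternion requires. *)
Lemma quat_skew A : A ^t* *m h + h *m A = 0 -> split_quaternion (quat A).
Proof.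
move=> Ah; have trA := skew_trace Ah.
have hAh : h *m A ^t* *m h = - A.
  move/eqP: Ah; rewrite addr_eq0 => /eqP; rewrite -mulmxA => ->.
  by rewrite mulmxN hhmul.
rewrite /split_quaternion /quat ctmxD ctmxZ ctmx1 mulmxDr mulmxDl hAh.
rewrite -scalemxAr -scalemxAl mulmx1 h_sqr mxtraceD mxtraceZ mxtrace1.
rewrite !rmorphM rmorphB !fmorphV /= rmorph1 rmorph_nat w_conj trA invrN.
rewrite -[(_ + _)%:M]scalemx1.
apply/matrixP => i j; rewrite !mx_entries; field; exact: w_neq0.
Qed.

Lemma extension_skew X : \tr X = 0 ->
  skew_hermitian (block_mx h 0 0 HN) X ->
  skew_hermitian (block_mx h 0 0 HN) (extension s S X).
Proof.
move=> X0; rewrite -{1}[X]submxK => /skew_block [hA hB hE hD].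
have hs : s ^t* *m h = - (h *m s).
  have := congr1 (mulmx h) s_quat.
  rewrite -mulmxA hhmul s_tr => ->.
  by rewrite mulmxBr mul_mx_scalar scale0r sub0r.
set b := s *m quat (ulsubmx X).
have bq : split_quaternion b by apply: split_quaternionM => //; exact: quat_skew.
have trb := split_quaternion_trace bq.
rewrite /extension -/b; apply/skew_block; split.
- have -> : (b + ((w - 1) / 2 * \tr b) *: 1%:M) ^t* *m h =
            h *m (h *m b ^t* *m h + (((w - 1) / 2 * \tr b)^* ) *: 1%:M).
    rewrite ctmxD ctmxZ ctmx1 mulmxDl mulmxDr -!mulmxA hhmul.
    by rewrite -scalemxAl -scalemxAr mul1mx mulmx1.
  rewrite bq -mulmxDr !rmorphM rmorphB fmorphV /= rmorph1 rmorph_nat w_conj trb.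
  rewrite -[(\tr b)%:M]scalemx1.
  have -> : (\tr b *: 1%:M - b + (((- w) - 1) / 2 * \tr b) *: 1%:M +
      (b + ((w - 1) / 2 * \tr b) *: 1%:M)) = 0 :> 'M[C]_2.
    by apply/matrixP => i j; rewrite !mx_entries; field.
  by rewrite mulmx0.
- rewrite ctmxN ctmxM mulNmx -mulmxA.
  move/eqP: hB; rewrite addr_eq0 => /eqP ->.
  by rewrite mulmxN opprK [_ *m (h *m _)]mulmxA hs mulNmx -mulmxA addNr.
- rewrite ctmxM -mulmxA hs mulmxN mulmxN mulmxA.
  move/eqP: hE; rewrite addr_eq0 => /eqP ->.
  by rewrite mulNmx opprK mulmxA subrr.
- have trD : (\tr (drsubmx X))^* = - \tr (drsubmx X).
    have := mxtrace_block (ulsubmx X) (ursubmx X) (dlsubmx X) (drsubmx X).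
    rewrite submxK X0 => /esym/eqP; rewrite addrC addr_eq0 => /eqP ->.
    by rewrite rmorphN /= (skew_trace hA).
  have D0 : skew_hermitian HN (detrace (drsubmx X)).
    rewrite /skew_hermitian /detrace ctmxD ctmxN ctmxZ ctmx1 mulmxDl mulmxDr mulNmx mulmxN.
    rewrite -scalemxAl -scalemxAr mul1mx mulmx1 addrACA hD add0r.
    by rewrite rmorphM fmorphV /= rmorph_nat trD mulNr scaleNr opprK subrr.
  have := sls_skew SP (mxtrace_detrace _) D0; rewrite /skew_hermitian => SD0.
  rewrite ctmxD ctmxN ctmxZ ctmx1 mulmxDl mulmxDr mulNmx mulmxN.
  rewrite -scalemxAl -scalemxAr mul1mx mulmx1 addrACA SD0 add0r.
  by rewrite !rmorphM fmorphV /= rmorph_nat w_conj trb !mulNr scaleNr opprK subrr.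
Qed.

Lemma sl_structure_extension : sl_structure (block_mx h 0 0 HN) eps (extension s S).
Proof.
split; first exact: extension_linear.
- by move=> X _; exact: mxtrace_extension.
- exact: extension_square.
- exact: extension_nijenhuis.
- exact: extension_form.
- exact: extension_skew.
Qed.
End Step.
End Extension.

(** * Structure pairs for all Hermitian forms of signature (m, m-1) *)

Definition mat2 (a b c d : C) : 'M[C]_2 :=
  \matrix_(i, j) if i == 0 then (if j == 0 then a else b)
                 else (if j == 0 then c else d).

Lemma mat2E a b c d : ((mat2 a b c d 0 0 = a) * (mat2 a b c d 0 1 = b)
  * (mat2 a b c d 1 0 = c) * (mat2 a b c d 1 1 = d))%type.
Proof. by rewrite !mxE. Qed.

Lemma mat2_ct a b c d : (mat2 a b c d) ^t* = mat2 a^* c^* b^* d^*.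
Proof. by apply: matrix2P; rewrite !mxE. Qed.

Let ii : 'i * 'i = - 1 :> C. Proof. by rewrite -expr2 sqrCi. Qed.

Lemma pair_extension N (HN : 'M[C]_N) : (0 < N)%N -> sl_structure_pair HN ->
  sl_structure_pair (block_mx (mat2 1 0 0 (- 1)) 0 0 HN).
Proof.
move=> N0 [J] [P] [JP PP anti].
pose r : C := sqrtC (N%:R / N.+2%:R); pose w : C := 'i * r.
have r_real : r^* = r.
  by apply/CrealP/ger0_real; rewrite sqrtC_ge0 divr_ge0 ?ler0n.
have w_sqr : w ^+ 2 = - (N%:R / N.+2%:R).
  by rewrite exprMn sqrCi sqrtCK mulN1r.
have w_conj : w^* = - w by rewrite rmorphM /= conjCi r_real mulNr.
pose h := mat2 1 0 0 (- 1).
have h_ct : h ^t* = h.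
  by rewrite mat2_ct rmorph1 rmorph0 rmorphN rmorph1.
have h_sqr : h *m h = 1%:M.
  by apply: matrix2P; rewrite !mulmx2E !mat2E !mxE /=; ring.
(* Both matrices lie in su(1, 1) for the form h; their squares are - 1 and 1, and they
   anticommute. *)
pose j := mat2 'i 0 0 (- 'i); pose p := mat2 0 1 1 0.
exists (extension w j J), (extension w p P); split.
- apply: sl_structure_extension => //; rewrite ?mxtrace2 ?mat2E ?subrr //.
    by apply: matrix2P; rewrite !mulmx2E !mat2E !mxE /= ?mulrNN ?ii; ring.
  rewrite /split_quaternion mat2_ct !rmorphN rmorph0 /= conjCi.
  apply: matrix2P; rewrite !(mulmx2E, mat2E, mxE, mxtrace2, mx_entries) /=; ring.
- apply: sl_structure_extension => //; rewrite ?mxtrace2 ?mat2E ?addr0 //.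
    by apply: matrix2P; rewrite !mulmx2E !mat2E !mxE /=; ring.
  rewrite /split_quaternion mat2_ct rmorph1 rmorph0 /=.
  apply: matrix2P; rewrite !(mulmx2E, mat2E, mxE, mxtrace2, mx_entries) /=; ring.
- move=> X X0; rewrite (assemble_surj N0 w_sqr X0).
  have D0 := mxtrace_detrace N0 (drsubmx X).
  rewrite !(extension_assemble N0 w_sqr) ?(sls_trace JP) ?(sls_trace PP) //.
  rewrite -[in RHS]scaleN1r (assembleZ w) !scaleN1r anti // !mulmxA !mulNmx.
  have pj : p *m j = - (j *m p).
    by apply: matrix2P; rewrite !(mx_entries, mulmx2E, mat2E); ring.
  congr assemble; first by rewrite pj mulNmx.
    by rewrite pj mulNmx.
  by rewrite !opprK -!mulmxA pj mulmxN opprK.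
Qed.

Lemma sl_structure_congruence n (H Q : 'M[C]_n) eps S : Q \in unitmx ->
  sl_structure H eps S ->
  sl_structure (Q ^t* *m H *m Q) eps (fun X => invmx Q *m S (Q *m X *m invmx Q) *m Q).
Proof.
move=> Qu SP.
have QV k (x : 'M[C]_(n, k)) : Q *m (invmx Q *m x) = x by rewrite mulmxA mulmxV ?mul1mx.
have VQ k (x : 'M[C]_(n, k)) : invmx Q *m (Q *m x) = x by rewrite mulmxA mulVmx ?mul1mx.
have QVr k (x : 'M[C]_(k, n)) : x *m Q *m invmx Q = x by rewrite -mulmxA mulmxV ?mulmx1.
have VQr k (x : 'M[C]_(k, n)) : x *m invmx Q *m Q = x by rewrite -mulmxA mulVmx ?mulmx1.
have trV x : \tr (invmx Q *m x *m Q) = \tr x by rewrite mxtrace_mulC QV.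
have trQ x : \tr (Q *m x *m invmx Q) = \tr x by rewrite mxtrace_mulC VQ.
have brV x y : mxbr (invmx Q *m x *m Q) (invmx Q *m y *m Q) = invmx Q *m mxbr x y *m Q.
  by rewrite /mxbr mulmxBr mulmxBl -!mulmxA !QV.
have brQ x y : Q *m mxbr x y *m invmx Q = mxbr (Q *m x *m invmx Q) (Q *m y *m invmx Q).
  by rewrite /mxbr mulmxBr mulmxBl -!mulmxA !VQ.
have cancel1 x : Q *m (invmx Q *m x *m Q) *m invmx Q = x.
  by rewrite -mulmxA QVr QV.
have cancel2 x : invmx Q *m (Q *m x *m invmx Q) *m Q = x.
  by rewrite -mulmxA VQr VQ.
split.
- move=> k X Y; rewrite mulmxDr mulmxDl -scalemxAr -scalemxAl (sls_linear SP).
  by rewrite mulmxDr mulmxDl -scalemxAr -scalemxAl.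
- by move=> X X0; rewrite trV (sls_trace SP) // trQ.
- move=> X X0; rewrite cancel1 (sls_square SP) ?trQ //.
  by rewrite -scalemxAr -scalemxAl cancel2.
- move=> X Y X0 Y0; rewrite !brQ !cancel1 brV.
  rewrite -[mxbr X Y in LHS]cancel2 brQ scalemxAl scalemxAr.
  rewrite -!(mulmxDl, mulmxBl, mulmxDr, mulmxBr).
  by rewrite (sls_nijenhuis SP) ?trQ // mulmx0 mul0mx.
- move=> X Y X0 Y0.
  have -> : invmx Q *m S (Q *m X *m invmx Q) *m Q *m (invmx Q *m S (Q *m Y *m invmx Q) *m Q)
     = invmx Q *m (S (Q *m X *m invmx Q) *m S (Q *m Y *m invmx Q)) *m Q.
    by rewrite -!mulmxA !QV.
  rewrite trV (sls_form SP) ?trQ //; congr (_ * _).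
  rewrite -[RHS]trQ; congr mxtrace; by rewrite -!mulmxA !VQ.
- move=> X X0 Xsk.
  have skE Y : skew_hermitian H (Q *m Y *m invmx Q) <-> skew_hermitian (Q ^t* *m H *m Q) Y.
    have -> : skew_hermitian (Q ^t* *m H *m Q) Y <->
       (Q ^t* *m ((Q *m Y *m invmx Q) ^t* *m H + H *m (Q *m Y *m invmx Q)) *m Q = 0).
      rewrite /skew_hermitian mulmxDr mulmxDl !ctmxM -!mulmxA mulVmx // mulmx1.
      have QcV k (x : 'M[C]_(n, k)) : Q ^t* *m ((invmx Q) ^t* *m x) = x.
        by rewrite mulmxA -ctmxM mulVmx // ctmx1 mul1mx.
      by rewrite QcV.
    split; first by rewrite /skew_hermitian => ->; rewrite mulmx0 mul0mx.
    move=> E; rewrite /skew_hermitian.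
    have Qcu : Q ^t* \in unitmx by rewrite map_unitmx unitmx_tr.
    by rewrite -[LHS](mulKmx Qcu) -[X in _ *m X](mulmxK Qu) E mul0mx mulmx0.
  apply: (proj1 (skE _)); rewrite cancel1; apply: (sls_skew SP); first by rewrite trQ.
  exact: (proj2 (skE _) Xsk).
Qed.

Lemma pair_congruence n (H Q : 'M[C]_n) : Q \in unitmx ->
  sl_structure_pair H -> sl_structure_pair (Q ^t* *m H *m Q).
Proof.
move=> Qu [J] [P] [JP PP anti].
exists (fun X => invmx Q *m J (Q *m X *m invmx Q) *m Q),
       (fun X => invmx Q *m P (Q *m X *m invmx Q) *m Q); split.
- exact: sl_structure_congruence.
- exact: sl_structure_congruence.
- move=> X X0.
  have QK Y : Q *m (invmx Q *m Y *m Q) *m invmx Q = Y.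
    by rewrite !mulmxA mulmxV // mul1mx -mulmxA mulmxV // mulmx1.
  rewrite QK [X in - (_ *m J X *m _)]QK anti ?mulmxN ?mulNmx //.
  by rewrite mxtrace_mulC mulmxA mulVmx // mul1mx.
Qed.

Lemma diag_mx_perm n (d : 'rV[C]_n) (s : {perm 'I_n}) :
  diag_mx d = (perm_mx s) ^t* *m diag_mx (\row_i d 0 (s i)) *m perm_mx s.
Proof.
have -> : (perm_mx s : 'M[C]_n) ^t* = perm_mx s^-1%g.
  by rewrite tr_perm_mx map_perm_mx.
have E : perm_mx s = perm_mx (s^-1)^-1 :> 'M[C]_n by rewrite invgK.
rewrite -row_permE [X in _ *m X]E -col_permE.
apply/matrixP => i j; rewrite !mxE permKV; congr (_ *+ _).
by rewrite (inj_eq perm_inj).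
Qed.

(** A sign vector of sum 1 and length at least 2 contains both signs. A permutation moves one of
    each to the front, and the remaining entries again have sum 1; allowing any order of the signs
    is what lets the induction continue. *)
Lemma pair_diag n (d : 'rV[C]_n) : (forall i, d 0 i = 1 \/ d 0 i = -1) ->
  \sum_i d 0 i = 1 -> sl_structure_pair (diag_mx d).
Proof.
have [k] := ubnP n; elim: k n d => // k IH n d nk d1 dsum.
case: n => [|[|n]] in d d1 dsum nk *.
- by move/eqP: dsum; rewrite big_ord0 eq_sym oner_eq0.
(* Base case: sl(1) is zero, so the zero map is a structure for every eps. *)
- have X0 (X : 'M[C]_1) : \tr X = 0 -> X = 0.
    rewrite /mxtrace big_ord1 => X0; apply/matrixP => i j.
    by rewrite !ord1 X0 mxE.
  have zero eps : sl_structure (diag_mx d) eps (fun=> 0).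
    split=> [k' X Y|X _|X /X0 ->|X Y /X0 -> _|X Y /X0 -> _|X _ _].
    + by rewrite scaler0 addr0.
    + exact: mxtrace0.
    + by rewrite scaler0.
    + by rewrite /mxbr !mul0mx !mulmx0 subrr scaler0 addr0 !subr0.
    + by rewrite !mul0mx mxtrace0 mulr0.
    + by rewrite /skew_hermitian trmx0 map_mx0 mul0mx mulmx0 addr0.
  by exists (fun=> 0), (fun=> 0); split=> // X _; rewrite oppr0.
- have const_sum (c : C) : (forall i, d 0 i = c) -> n.+2%:R * c = 1.
    move=> dc; rewrite mulr_natl -dsum (eq_bigr (fun=> c)) => [|i _]; last exact: dc.
    by rewrite sumr_const card_ord.
  have [i di] : exists i, d 0 i = 1.
    apply: contrapT => no; have : n.+2%:R * - 1 = 1 :> C.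
      by apply: const_sum => i; case: (d1 i) => // di; case: no; exists i.
    move/eqP; rewrite mulrN1 eq_sym -addr_eq0.
    by rewrite nat1r pnatr_eq0.
  have [j dj] : exists j, d 0 j = -1.
    apply: contrapT => no; have : n.+2%:R * 1 = 1 :> C.
      by apply: const_sum => j; case: (d1 j) => // dj; case: no; exists j.
    by move/eqP; rewrite mulr1 pnatr_eq1.
  have ji : j != i.
    apply/eqP => jieq; move/eqP: dj; rewrite jieq di -addr_eq0.
    by rewrite -[1 + 1]/(2%:R) pnatr_eq0.
  pose o0 : 'I_n.+2 := 0; pose o1 : 'I_n.+2 := 1.
  (* Permutations compose from left to right. The last transposition sends 0 to i; the first one
     sends 1 to the preimage of j under it and fixes 0, which also covers j = 0 and i = 1. *)
  pose s : {perm 'I_n.+2} := (tperm o1 (tperm o0 i j) * tperm o0 i)%g.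
  have s0 : s o0 = i.
    have t0 : tperm o1 (tperm o0 i j) o0 = o0.
      by apply: tpermD => //; rewrite -[X in _ != X](tpermR o0 i) (inj_eq perm_inj).
    by rewrite /s permM t0 tpermL.
  have s1 : s o1 = j by rewrite /s permM tpermL tpermK.
  rewrite (diag_mx_perm d s); apply: pair_congruence; first exact: unitmx_perm.
  set e : 'rV[C]_(2 + n) := \row_i _.
  have e1 p : e 0 p = 1 \/ e 0 p = - 1 by rewrite mxE.
  have el : lsubmx e 0 0 = 1 /\ lsubmx e 0 1 = - 1.
    rewrite !mxE; split; [rewrite -di -s0|rewrite -dj -s1];
    by congr (d _ (s _)); apply: val_inj.
  have er : \sum_p rsubmx e 0 p = 1.
    have <- : \sum_p e 0 p = 1.
      rewrite -dsum [RHS](reindex_inj (@perm_inj _ s)).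
      by apply: eq_bigr => p _; rewrite mxE.
    rewrite -[e in RHS]hsubmxK big_split_ord /=.
    rewrite !big_ord_recl big_ord0 !row_mxEl addr0.
    rewrite el.1 (_ : lift _ _ = 1) ?el.2; last exact: val_inj.
    by rewrite subrr add0r; apply: eq_bigr => p _; rewrite row_mxEr.
  have -> : diag_mx e = block_mx (diag_mx (lsubmx e)) 0 0 (diag_mx (rsubmx e)) :> 'M[C]_(2 + n).
    by rewrite -diag_mx_row hsubmxK.
  have -> : diag_mx (lsubmx e) = mat2 1 0 0 (- 1).
    by apply: matrix2P; rewrite mat2E mxE ?el.1 ?el.2 ?mulr1n ?mulr0n.
  apply: pair_extension.
    case: (n) e e1 el er => // e _ _; rewrite big_ord0 => /esym/eqP.
    by rewrite oner_eq0.
  apply: IH => // [|p]; first by rewrite -ltnS ltnW.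
  by rewrite mxE; exact: e1.
Qed.

Lemma pair_signature m (Q : 'M[C]_(m.+1 + m)) : Q \in unitmx ->
  sl_structure_pair (Q ^t* *m block_mx 1%:M 0 0 (- 1%:M) *m Q).
Proof.
move=> Qu; apply: pair_congruence => //.
have -> : block_mx 1%:M 0 0 (- 1%:M) =
    diag_mx (row_mx (const_mx 1) (const_mx (- 1))) :> 'M[C]_(m.+1 + m).
  by rewrite diag_mx_row !diag_const_mx rmorphN.
apply: pair_diag => [i|].
  by case: (split_ordP i) => k ->; rewrite ?row_mxEl ?row_mxEr mxE; [left|right].
rewrite big_split_ord /=.
under eq_bigr do rewrite row_mxEl mxE.
under [X in _ + X]eq_bigr do rewrite row_mxEr mxE.
by rewrite !sumr_const !card_ord mulNrn -natr1 addrC addKr.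
Qed.
End InvariantStructures.

(** * Smooth functions on open sets *)

Section SmoothCalculus.
Context {R : realType} {V : normedModType R}.
Implicit Types (U : set V) (W : normedModType R).

Lemma near_eq_differentiable W (f g : V -> W) (x : V) :
  (\near x, f x = g x) -> differentiable f x -> differentiable g x.
Proof.
move=> fg df; have fgx : f x = g x by exact: (nbhs_singleton fg).
have H : continuous ('d f x : V -> W) /\
    g \o shift x = cst (g x) + ('d f x : V -> W) +o_ (0 : V) id.
  have [dc Hf] := (diff_locallyP _ _).1 df; split => //.
  move/eqaddoP : Hf => Hf; apply/eqaddoP => e e0.
  have fg0 : \forall h \near (0 : V), f (h + x) = g (h + x).
    by move: fg; rewrite (near_shift 0 x) /=; apply: filterS => h; rewrite subr0.
  near=> h; have -> : (g \o shift x - (cst (g x) + 'd f x)) h =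
      (f \o shift x - (cst (f x) + 'd f x)) h.
    by rewrite !fctE /= fgx; congr (_ - _); rewrite (near fg0 h).
  by near: h; exact: Hf.
apply/diff_locallyP; rewrite (_ : ('d g x : V -> W) = 'd f x) //.
by apply: diff_unique; case: H.
Unshelve. all: by end_near. Qed.

(** The rules for derivatives of sums, products and inverses hold only at points of U, so the
    inductions on k need invariance under equality on U. *)
Lemma is_Ck_ext W k U (f g : V -> W) : open U ->
  (forall x, U x -> f x = g x) -> is_Ck k U f -> is_Ck k U g.
Proof.
move=> Uo; elim: k f g => [|k IH] f g fg.
  move=> fC x Ux; have fgn : \near x, f x = g x.
    by move: (open_nbhs_nbhs (conj Uo Ux)); apply: filterS => y /fg.
  change (g y @[y --> x] --> g x); rewrite -(fg x Ux).
  apply: cvg_trans (fC x Ux).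
  exact: near_eq_cvg.
have fgn x : U x -> \near x, f x = g x.
  by move=> Ux; move: (open_nbhs_nbhs (conj Uo Ux)); apply: filterS => y /fg.
move=> [fd fC]; split=> [x Ux|v]; first exact: near_eq_differentiable (fgn x Ux) (fd x Ux).
by apply: IH (fC v) => x Ux; apply: near_eq_derive; exact: fgn.
Qed.

Lemma is_CkW W k U (f : V -> W) : is_Ck k.+1 U f -> is_Ck k U f.
Proof.
elim: k f => [|k IH] f [fd fC] /=.
  by move=> x Ux; exact/differentiable_continuous/fd.
by split=> // v; apply: IH; exact: fC.
Qed.

Lemma is_Ck_cst W k U (a : W) : is_Ck k U (cst a).
Proof.
elim: k a => [|k IH] a /=; first by move=> x _; exact: cst_continuous.
split=> [x _|v]; first exact: differentiable_cst.
rewrite (_ : (fun x => _) = cst 0) //; apply/funext => x; exact: derive_cst.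
Qed.

Lemma is_Ck_linear W k U (L : {linear V -> W}) : continuous L -> is_Ck k U L.
Proof.
move=> Lc; case: k => [|k] /=; first by move=> x _; exact: Lc.
split=> [x _|v]; first exact: linear_differentiable.
rewrite (_ : (fun x => _) = cst (L v)); first exact: is_Ck_cst.
by apply/funext => x; rewrite deriveE ?diff_lin //; exact: linear_differentiable.
Qed.

Lemma is_CkD W k U (f g : V -> W) : open U ->
  is_Ck k U f -> is_Ck k U g -> is_Ck k U (f + g).
Proof.
move=> Uo; elim: k f g => [|k IH] f g.
  by move=> fC gC x Ux; apply: cvgD; [exact: fC|exact: gC].
move=> [fd fC] [gd gC]; split=> [x Ux|v].
  by apply: differentiableD; [exact: fd|exact: gd].
apply: is_Ck_ext (IH _ _ (fC v) (gC v)) => // x Ux; rewrite deriveD //.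
  exact/diff_derivable/fd.
exact/diff_derivable/gd.
Qed.

Lemma is_CkM k U (f g : V -> R^o) : open U ->
  is_Ck k U f -> is_Ck k U g -> is_Ck k U (fun x => f x * g x : R^o).
Proof.
move=> Uo; elim: k f g => [|k IH] f g.
  by move=> fC gC x Ux; apply: cvgM; [exact: fC|exact: gC].
move=> fk gk; have [[fd fC] [gd gC]] := (fk, gk); split=> [x Ux|v].
  by apply: differentiableM; [exact: fd|exact: gd].
apply: is_Ck_ext (is_CkD Uo (IH _ _ (is_CkW fk) (gC v)) (IH _ _ (is_CkW gk) (fC v))) => //.
move=> x Ux; rewrite [RHS]deriveM //.
  exact/diff_derivable/fd.
exact/diff_derivable/gd.
Qed.

(** The derivative of 1 / f is - f' / f^2, which involves 1 / f only to the order k already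
    known. *)
Lemma is_CkV k U (f : V -> R^o) : open U -> (forall x, U x -> f x != 0) ->
  is_Ck k U f -> is_Ck k U (fun x => (f x)^-1 : R^o).
Proof.
move=> Uo f0; elim: k => [|k IH].
  by move=> fC x Ux; apply: cvgV; [exact: f0|exact: fC].
move=> fk; have [fd fC] := fk; split=> [x Ux|v].
  by apply: differentiableV; [exact: fd|exact: f0].
have fVk := IH (is_CkW fk).
apply: is_Ck_ext (is_CkM Uo (is_Ck_cst k U (- 1 : R^o))
  (is_CkM Uo (is_CkM Uo fVk fVk) (fC v))) => // x Ux.
rewrite [RHS]deriveV ?f0 //; last exact/diff_derivable/fd.
by rewrite mulN1r /cst scaleNr -invfM -expr2.
Qed.

Lemma is_CkZl W k U (f : V -> R^o) (w : W) : open U ->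
  is_Ck k U f -> is_Ck k U (fun x => f x *: w).
Proof.
move=> Uo; elim: k f => [|k IH] f.
  by move=> fC x Ux; apply: cvgZr_tmp; exact: fC.
move=> [fd fC]; split=> [x Ux|v]; first exact/differentiableZl/fd.
apply: is_Ck_ext (IH _ (fC v)) => // x Ux.
rewrite [RHS]deriveE; last exact/differentiableZl/fd.
by rewrite diffZl ?deriveE //; exact: fd.
Qed.

Lemma is_Ck_sum W k U (I : Type) (r : seq I) (f : I -> V -> W) : open U ->
  (forall i, is_Ck k U (f i)) -> is_Ck k U (fun x => \sum_(i <- r) f i x).
Proof.
move=> Uo fC; elim: r => [|i r IH].
  by under eq_fun do rewrite big_nil; exact: is_Ck_cst.
by under eq_fun do rewrite big_cons; exact: is_CkD.
Qed.
End SmoothCalculus.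

(** * Complex-valued and matrix-valued smooth functions *)

Section ComplexParts.
Context {R : realType}.
Implicit Types x y : R[i].

Lemma complex_eqP x y :
  complex.Re x = complex.Re y -> complex.Im x = complex.Im y -> x = y.
Proof. by case: x y => [a b] [a' b'] /= -> ->. Qed.

Lemma Rec_add x y : complex.Re (x + y) = complex.Re x + complex.Re y.
Proof. by case: x y => [? ?] [? ?]. Qed.
Lemma Imc_add x y : complex.Im (x + y) = complex.Im x + complex.Im y.
Proof. by case: x y => [? ?] [? ?]. Qed.
Lemma Rec_mul x y : complex.Re (x * y) =
  complex.Re x * complex.Re y - complex.Im x * complex.Im y.
Proof. by case: x y => [? ?] [? ?]. Qed.
Lemma Imc_mul x y : complex.Im (x * y) =
  complex.Re x * complex.Im y + complex.Im x * complex.Re y.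
Proof. by case: x y => [? ?] [? ?]. Qed.
Lemma Rec_conj x : complex.Re x^* = complex.Re x. Proof. by case: x. Qed.
Lemma Imc_conj x : complex.Im x^* = - complex.Im x. Proof. by case: x. Qed.
Lemma Rec_sum (I : Type) (r : seq I) (P : pred I) (F : I -> R[i]) :
  complex.Re (\sum_(i <- r | P i) F i) = \sum_(i <- r | P i) complex.Re (F i).
Proof. by elim/big_ind2: _ => // x1 x2 y1 y2 <- <-; exact: Rec_add. Qed.
End ComplexParts.

(** This reduces smoothness and differentiability of a matrix-valued map to those of scalar
    functions multiplying constant vectors. *)
Lemma of_cmx_sum (R : realType) n (A : 'M[R[i]]_n) :
  of_cmx A = \sum_(p : 'I_n * 'I_n)
    (complex.Re (A p.1 p.2) *: ((delta_mx p.1 p.2, 0) : rmat R n) +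
     complex.Im (A p.1 p.2) *: ((0, delta_mx p.1 p.2) : rmat R n)).
Proof.
rewrite big_split /=; apply/eqP; rewrite xpair_eqE; apply/andP; split; apply/eqP.
  rewrite !raddf_sum /= [X in _ + X]big1 ?addr0 => [|p _]; last by rewrite scaler0.
  rewrite -(pair_bigA _ (fun i j => complex.Re (A i j) *: delta_mx i j)) /=.
  rewrite [LHS]matrix_sum_delta; apply: eq_bigr => i _; apply: eq_bigr => j _.
  by congr (_ *: _); rewrite mxE.
rewrite !raddf_sum /= [X in X + _]big1 ?add0r => [|p _]; last by rewrite scaler0.
rewrite -(pair_bigA _ (fun i j => complex.Im (A i j) *: delta_mx i j)) /=.
rewrite [LHS]matrix_sum_delta; apply: eq_bigr => i _; apply: eq_bigr => j _.
by congr (_ *: _); rewrite mxE.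
Qed.

Section ComplexSmooth.
Context {R : realType} {V : normedModType R}.
Variable U : set V.
Hypothesis Uo : open U.

(** The calculus is over the reals and the algebra over [R[i]]; real and imaginary parts of entries
    link the two. *)
Definition csmooth (f : V -> R[i]) :=
  smooth_open U (fun x => complex.Re (f x) : R^o) /\
  smooth_open U (fun x => complex.Im (f x) : R^o).

Definition mxsmooth m n (F : V -> 'M[R[i]]_(m, n)) :=
  forall i j, csmooth (fun x => F x i j).

Lemma csmooth_cst a : csmooth (fun=> a).
Proof. by split=> k; exact: is_Ck_cst. Qed.

Lemma csmoothD f g : csmooth f -> csmooth g -> csmooth (fun x => f x + g x).
Proof.
move=> [fr fi] [gr gi]; split=> k; under eq_fun do rewrite ?Rec_add ?Imc_add;
  by apply: is_CkD => //.
Qed.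

Lemma csmoothM f g : csmooth f -> csmooth g -> csmooth (fun x => f x * g x).
Proof.
move=> [fr fi] [gr gi]; split=> k.
  under eq_fun do rewrite Rec_mul -mulN1r.
  apply: is_CkD => //; first exact: is_CkM.
  by apply: is_CkM => //; [exact: is_Ck_cst|exact: is_CkM].
under eq_fun do rewrite Imc_mul.
by apply: is_CkD => //; exact: is_CkM.
Qed.

Lemma csmooth_conj f : csmooth f -> csmooth (fun x => (f x)^*).
Proof.
move=> [fr fi]; split=> k.
  by under eq_fun do rewrite Rec_conj; exact: fr.
under eq_fun do rewrite Imc_conj -mulN1r.
by apply: is_CkM => //; exact: is_Ck_cst.
Qed.

Lemma csmooth_sum (I : Type) (r : seq I) (P : pred I) (f : I -> V -> R[i]) :
  (forall i, P i -> csmooth (f i)) -> csmooth (fun x => \sum_(i <- r | P i) f i x).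
Proof.
move=> fs; elim: r => [|i r IH].
  by under eq_fun do rewrite big_nil; exact: csmooth_cst.
under eq_fun do rewrite big_cons; case: (boolP (P i)) => // Pi.
exact/csmoothD/IH/fs.
Qed.

Lemma csmooth_prod (I : Type) (r : seq I) (P : pred I) (f : I -> V -> R[i]) :
  (forall i, P i -> csmooth (f i)) -> csmooth (fun x => \prod_(i <- r | P i) f i x).
Proof.
move=> fs; elim: r => [|i r IH].
  by under eq_fun do rewrite big_nil; exact: csmooth_cst.
under eq_fun do rewrite big_cons; case: (boolP (P i)) => // Pi.
exact/csmoothM/IH/fs.
Qed.

Lemma csmoothV f : (forall x, U x -> f x != 0) -> csmooth f ->
  csmooth (fun x => (f x)^-1).
Proof.
move=> f0 [fr fi].
pose q x : R^o := complex.Re (f x) * complex.Re (f x) + complex.Im (f x) * complex.Im (f x).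
have q0 x : U x -> q x != 0.
  move=> /f0; rewrite /q; case: (f x) => a b /= ab; rewrite -!expr2 paddr_eq0 ?sqr_ge0 //.
  by rewrite !sqrf_eq0; apply: contra ab => /andP[/eqP -> /eqP ->].
have qV k : is_Ck k U (fun x => (q x)^-1 : R^o).
  by apply: is_CkV => //; apply: is_CkD => //; exact: is_CkM.
have invE x : (f x)^-1 = (complex.Re (f x) * (q x)^-1 +i* (- 1 * complex.Im (f x) * (q x)^-1))%C.
  rewrite /q; case: (f x) => a b /=; rewrite /GRing.inv /= -!expr2.
  by rewrite mulN1r mulNr.
split=> k; under eq_fun do rewrite invE /=; apply: is_CkM => //.
by apply: is_CkM => //; exact: is_Ck_cst.
Qed.

Lemma mxsmooth_cst m n (A : 'M[R[i]]_(m, n)) : mxsmooth (fun=> A).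
Proof. by move=> i j; exact: csmooth_cst. Qed.

Lemma mxsmoothD m n (F G : V -> 'M[R[i]]_(m, n)) :
  mxsmooth F -> mxsmooth G -> mxsmooth (fun x => F x + G x).
Proof.
by move=> Fs Gs i j; under eq_fun do rewrite mxE; exact: csmoothD.
Qed.

Lemma mxsmoothM m n p (F : V -> 'M[R[i]]_(m, n)) (G : V -> 'M[R[i]]_(n, p)) :
  mxsmooth F -> mxsmooth G -> mxsmooth (fun x => F x *m G x).
Proof.
move=> Fs Gs i j; under eq_fun do rewrite mxE.
by apply: csmooth_sum => k _; exact: csmoothM.
Qed.

Lemma mxsmoothZ m n (f : V -> R[i]) (F : V -> 'M[R[i]]_(m, n)) :
  csmooth f -> mxsmooth F -> mxsmooth (fun x => f x *: F x).
Proof. by move=> fs Fs i j; under eq_fun do rewrite mxE; exact: csmoothM. Qed.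

Lemma csmooth_det n (F : V -> 'M[R[i]]_n) :
  mxsmooth F -> csmooth (fun x => \det (F x)).
Proof.
move=> Fs; apply: csmooth_sum => s _; apply: csmoothM; first exact: csmooth_cst.
by apply: csmooth_prod => i _; exact: Fs.
Qed.

Lemma mxsmooth_adj n (F : V -> 'M[R[i]]_n) :
  mxsmooth F -> mxsmooth (fun x => \adj (F x)).
Proof.
move=> Fs i j; under eq_fun do rewrite mxE.
apply: csmoothM; first exact: csmooth_cst.
apply: csmooth_det => a b; under eq_fun do rewrite !mxE; exact: Fs.
Qed.

Lemma linear_mx_sum n (S : 'M[R[i]]_n -> 'M[R[i]]_n) A :
  mx_linear S ->
  S A = \sum_i \sum_j A i j *: S (delta_mx i j).
Proof.
move=> Sl.
have S0 : S 0 = 0.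
  by have := Sl (-1) 0 0; rewrite scaler0 addr0 scaleN1r addNr.
have SD X Y : S (X + Y) = S X + S Y by rewrite -[X in LHS]scale1r Sl scale1r.
have SZ k X : S (k *: X) = k *: S X by rewrite -[k *: X]addr0 Sl S0 addr0.
rewrite {1}[A]matrix_sum_delta.
rewrite (big_morph S SD S0); apply: eq_bigr => i _.
by rewrite (big_morph S SD S0); apply: eq_bigr => j _.
Qed.

Lemma mxsmooth_linear n (S : 'M[R[i]]_n -> 'M[R[i]]_n) (F : V -> 'M[R[i]]_n) :
  mx_linear S ->
  mxsmooth F -> mxsmooth (fun x => S (F x)).
Proof.
move=> Sl Fs a b; under eq_fun do rewrite (linear_mx_sum _ Sl) summxE.
apply: csmooth_sum => i _; under eq_fun do rewrite summxE.
apply: csmooth_sum => j _; under eq_fun do rewrite mxE.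
by apply: csmoothM; [exact: Fs|exact: csmooth_cst].
Qed.

Lemma smooth_of_cmx n (F : V -> 'M[R[i]]_n) :
  mxsmooth F -> smooth_open U (fun x => of_cmx (F x)).
Proof.
move=> Fs k; under eq_fun do rewrite of_cmx_sum.
apply: is_Ck_sum => // p; apply: is_CkD => //; apply: is_CkZl => //.
  by case: (Fs p.1 p.2).
by case: (Fs p.1 p.2).
Qed.
End ComplexSmooth.

(** * Derivatives of matrix-valued curves *)

Section RealCoordinates.
Context {R : realType} {n : nat}.
Implicit Types (u v : rmat R n) (A : 'M[R[i]]_n).

Lemma to_cmxE u i j : to_cmx u i j = (u.1 i j +i* u.2 i j)%C.
Proof. by rewrite mxE. Qed.

Lemma of_cmxK A : to_cmx (of_cmx A) = A.
Proof. by apply/matrixP => i j; rewrite to_cmxE /= !mxE; case: (A i j). Qed.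

Lemma to_cmxK u : of_cmx (to_cmx u) = u.
Proof.
by case: u => a b; rewrite /of_cmx; congr pair; apply/matrixP => i j; rewrite !mxE.
Qed.

Lemma to_cmx_inj u v : to_cmx u = to_cmx v -> u = v.
Proof. by move=> /(congr1 of_cmx); rewrite !to_cmxK. Qed.

Lemma to_cmx_linear (a : R) u v : to_cmx (a *: u + v) = a%:C%C *: to_cmx u + to_cmx v.
Proof.
apply/matrixP => i j; rewrite !mxE; apply: complex_eqP => /=; rewrite ?mxE.
  by rewrite mul0r subr0.
by rewrite mul0r addr0.
Qed.

Lemma to_cmx0 : to_cmx 0 = 0 :> 'M[R[i]]_n.
Proof. by apply/matrixP => i j; rewrite !mxE. Qed.

Lemma to_cmxD u v : to_cmx (u + v) = to_cmx u + to_cmx v.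
Proof. by have := to_cmx_linear 1 u v; rewrite !scale1r. Qed.

Lemma to_cmxZ a u : to_cmx (a *: u) = a%:C%C *: to_cmx u.
Proof. by have := to_cmx_linear a u 0; rewrite to_cmx0 !addr0. Qed.

Lemma to_cmxN u : to_cmx (- u) = - to_cmx u.
Proof. by rewrite -scaleN1r to_cmxZ rmorphN rmorph1 scaleN1r. Qed.

Lemma to_cmxB u v : to_cmx (u - v) = to_cmx u - to_cmx v.
Proof. by rewrite to_cmxD to_cmxN. Qed.

End RealCoordinates.

Section RealCoordinateForms.
Context {R : realType} {n : nat}.
Variables (i j : 'I_n).

Definition re_entry (u : rmat R n) : R^o := u.1 i j.
Definition im_entry (u : rmat R n) : R^o := u.2 i j.

Fact re_entry_linear : linear re_entry.
Proof. by move=> a x y; rewrite /re_entry !mxE. Qed.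
Fact im_entry_linear : linear im_entry.
Proof. by move=> a x y; rewrite /im_entry !mxE. Qed.
HB.instance Definition _ := GRing.isLinear.Build _ _ _ _ re_entry re_entry_linear.
HB.instance Definition _ := GRing.isLinear.Build _ _ _ _ im_entry im_entry_linear.

Lemma re_entry_continuous : continuous re_entry.
Proof.
move=> x; apply: (@continuous_comp _ _ _ fst (fun M : 'M[R]_n => M i j : R)).
  exact: cvg_fst.
exact: coord_continuous.
Qed.

Lemma im_entry_continuous : continuous im_entry.
Proof.
move=> x; apply: (@continuous_comp _ _ _ snd (fun M : 'M[R]_n => M i j : R)).
  exact: cvg_snd.
exact: coord_continuous.
Qed.
End RealCoordinateForms.

Lemma mxsmooth_to_cmx (R : realType) n (V : normedModType R) (U : set V)
    (L : {linear V -> rmat R n}) :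
  continuous L -> mxsmooth U (fun x => to_cmx (L x)).
Proof.
move=> Lc i j; split=> k; under eq_fun do rewrite to_cmxE /=.
  apply: (is_Ck_linear k U (L := @re_entry R n i j \o L)) => x.
  by apply: continuous_comp; [exact: Lc|exact: re_entry_continuous].
apply: (is_Ck_linear k U (L := @im_entry R n i j \o L)) => x.
by apply: continuous_comp; [exact: Lc|exact: im_entry_continuous].
Qed.

Section DerivativeAtZero.
Context {R : realType}.

Lemma is_derive_linear (V W : normedModType R) (L : {linear V -> W}) (c : R -> V) :
  continuous L -> differentiable (c : R^o -> V) 0 ->
  is_derive (0 : R^o) (1 : R^o) (fun t => L (c t)) (L (derive1 c 0)).
Proof.
move=> Lc cd.
have Lcd : differentiable (L \o (c : R^o -> V)) 0.
  by apply: differentiable_comp => //; exact: linear_differentiable.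
apply: DeriveDef; first exact: diff_derivable.
rewrite deriveE // diff_comp //; last exact: linear_differentiable.
by rewrite /= diff_lin // derive1E deriveE.
Qed.

(** A relation rather than a function: it carries existence and value of the derivative together,
    and only at 0, where the curves are differentiated. *)
Definition cderive (f : R -> R[i]) (a : R[i]) :=
  is_derive (0 : R^o) (1 : R^o) (fun t => complex.Re (f t) : R^o) (complex.Re a) /\
  is_derive (0 : R^o) (1 : R^o) (fun t => complex.Im (f t) : R^o) (complex.Im a).

Definition mxderive m n (F : R -> 'M[R[i]]_(m, n)) (A : 'M[R[i]]_(m, n)) :=
  forall i j, cderive (fun t => F t i j) (A i j).

Lemma cderive_unique f a b : cderive f a -> cderive f b -> a = b.
Proof.
move=> [ra ia] [rb ib]; apply: complex_eqP.
  by rewrite -(@derive_val _ _ _ _ _ _ _ ra) -(@derive_val _ _ _ _ _ _ _ rb).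
by rewrite -(@derive_val _ _ _ _ _ _ _ ia) -(@derive_val _ _ _ _ _ _ _ ib).
Qed.

Lemma cderive_ext f g a : (\forall t \near (0 : R), f t = g t) ->
  cderive f a -> cderive g a.
Proof.
move=> fg [fr fi]; split.
  by apply: near_eq_is_derive fr; apply: filterS fg => t ->.
by apply: near_eq_is_derive fi; apply: filterS fg => t ->.
Qed.

Lemma cderive_eq f a b : cderive f a -> a = b -> cderive f b.
Proof. by move=> fa <-. Qed.

Lemma cderive_cst a : cderive (fun=> a) 0.
Proof. by split; exact: is_derive_cst. Qed.

Lemma cderiveD f g a b : cderive f a -> cderive g b ->
  cderive (fun t => f t + g t) (a + b).
Proof.
move=> [fr fi] [gr gi]; split.
  by under eq_fun do rewrite Rec_add; rewrite Rec_add; exact: is_deriveD.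
by under eq_fun do rewrite Imc_add; rewrite Imc_add; exact: is_deriveD.
Qed.

Lemma cderiveM f g a b : cderive f a -> cderive g b ->
  cderive (fun t => f t * g t) (a * g 0 + f 0 * b).
Proof.
move=> [fr fi] [gr gi]; split.
  under eq_fun do rewrite Rec_mul.
  apply: is_derive_eq.
  by rewrite Rec_add !Rec_mul /GRing.scale /=; ring.
under eq_fun do rewrite Imc_mul.
apply: is_derive_eq.
by rewrite Imc_add !Imc_mul /GRing.scale /=; ring.
Qed.

Lemma cderive_conj f a : cderive f a -> cderive (fun t => (f t)^*) a^*.
Proof.
move=> [fr fi]; split.
  rewrite Rec_conj; apply: near_eq_is_derive fr.
  by apply: (@nearW _ (nbhs (0 : R^o))) => t; exact/esym/Rec_conj.
rewrite Imc_conj; apply: near_eq_is_derive (is_deriveN fi).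
by apply: (@nearW _ (nbhs (0 : R^o))) => t; exact/esym/Imc_conj.
Qed.

Lemma cderive_sum (I : Type) (r : seq I) (P : pred I) (f : I -> R -> R[i]) a :
  (forall i, P i -> cderive (f i) (a i)) ->
  cderive (fun t => \sum_(i <- r | P i) f i t) (\sum_(i <- r | P i) a i).
Proof.
move=> fs; elim: r => [|i r IH].
  by under eq_fun do rewrite big_nil; rewrite big_nil; exact: cderive_cst.
under eq_fun do rewrite big_cons; rewrite big_cons; case: (boolP (P i)) => // Pi.
by apply: cderiveD => //; exact: fs.
Qed.

Lemma cderive_prod (I : Type) (r : seq I) (P : pred I) (f : I -> R -> R[i]) a :
  (forall i, P i -> cderive (f i) (a i)) ->
  exists b, cderive (fun t => \prod_(i <- r | P i) f i t) b.
Proof.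
move=> fs; elim: r => [|i r [b IH]].
  by exists 0; under eq_fun do rewrite big_nil; exact: cderive_cst.
case: (boolP (P i)) => Pi; last first.
  by exists b; under eq_fun do rewrite big_cons (negbTE Pi).
exists (a i * \prod_(i <- r | P i) f i 0 + f i 0 * b).
by under eq_fun do rewrite big_cons Pi; apply: cderiveM => //; exact: fs.
Qed.

Lemma cderive_prod1 (I : Type) (r : seq I) (f : I -> R -> R[i]) a :
  (forall i, f i 0 = 1) -> (forall i, cderive (f i) (a i)) ->
  cderive (fun t => \prod_(i <- r) f i t) (\sum_(i <- r) a i).
Proof.
move=> f0 fs; elim: r => [|i r IH].
  by under eq_fun do rewrite big_nil; rewrite big_nil; exact: cderive_cst.
under eq_fun do rewrite big_cons; rewrite big_cons.
apply: cderive_eq (cderiveM (fs i) IH) _.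
by rewrite f0 mul1r big1 ?mulr1.
Qed.

(** In the Leibniz expansion a permutation s other than 1 moves some i and also s i. Its product
    then has two off-diagonal factors, both zero at t = 0, so its derivative is zero. *)
Lemma cderive_det1 n (F : R -> 'M[R[i]]_n) A : F 0 = 1%:M ->
  mxderive F A -> cderive (fun t => \det (F t)) (\tr A).
Proof.
move=> F0 FA.
have -> : \tr A = \sum_(s : 'S_n) (s == 1%g)%:R * \tr A.
  by rewrite (bigD1 1%g) //= eqxx mul1r big1 ?addr0 // => s /negbTE ->; rewrite mul0r.
apply: cderive_sum => s _; have [->|s1] := eqVneq s 1%g.
  rewrite mul1r odd_perm1 expr0.
  under eq_fun do rewrite mul1r.
  apply: cderive_prod1 => i; rewrite perm1; last exact: FA.
  by rewrite F0 mxE eqxx.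
rewrite mul0r.
have [i si] : exists i, s i != i.
  apply/existsP; apply: contraR s1; rewrite negb_exists => /forallP si.
  by apply/eqP/permP => i; rewrite perm1; apply/eqP; move: (si i); rewrite negbK.
have sj : s (s i) != s i by rewrite (inj_eq perm_inj).
have [b Fb] : exists b, cderive (fun t => \prod_(k | (k != i) && (k != s i)) F t k (s k)) b.
  by apply: cderive_prod => k _; exact: FA.
have FE t : (-1) ^+ s * \prod_k F t k (s k) =
    (-1) ^+ s * (F t i (s i) * (F t (s i) (s (s i)) *
      \prod_(k | (k != i) && (k != s i)) F t k (s k))).
  by rewrite (bigD1 i) //= (bigD1 (s i)).
under eq_fun do rewrite FE.
apply: cderive_eq.
  apply: cderiveM (cderive_cst _) _; apply: cderiveM (FA _ _) _.
  exact: cderiveM (FA _ _) Fb.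
by rewrite /= F0 !mxE [i == _]eq_sym (negbTE si) [s i == _]eq_sym (negbTE sj) /=
  !(mul0r, mulr0, addr0).
Qed.

Lemma cderive_det n (F : R -> 'M[R[i]]_n) A :
  mxderive F A -> exists b, cderive (fun t => \det (F t)) b.
Proof.
move=> FA.
have /choice[b Fb] : forall s : 'S_n, exists b,
    cderive (fun t => (-1) ^+ s * \prod_k F t k (s k)) b.
  move=> s; have [b Fb] : exists b, cderive (fun t => \prod_k F t k (s k)) b.
    by apply: cderive_prod => k _; exact: FA.
  by eexists; apply: cderiveM (cderive_cst _) Fb.
by exists (\sum_s b s); exact: cderive_sum.
Qed.

Lemma mxderive_unique m n (F : R -> 'M[R[i]]_(m, n)) A B :
  mxderive F A -> mxderive F B -> A = B.
Proof. by move=> FA FB; apply/matrixP => i j; exact: cderive_unique (FA i j) (FB i j). Qed.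

Lemma mxderive_ext m n (F G : R -> 'M[R[i]]_(m, n)) A :
  (\forall t \near (0 : R), F t = G t) -> mxderive F A -> mxderive G A.
Proof.
by move=> FG FA i j; apply: cderive_ext (FA i j); apply: filterS FG => t ->.
Qed.

Lemma mxderive_cst m n (A : 'M[R[i]]_(m, n)) : mxderive (fun=> A) 0.
Proof. by move=> i j; rewrite mxE; exact: cderive_cst. Qed.

Lemma mxderiveM m n p (F : R -> 'M[R[i]]_(m, n)) (G : R -> 'M[R[i]]_(n, p)) A B :
  mxderive F A -> mxderive G B ->
  mxderive (fun t => F t *m G t) (A *m G 0 + F 0 *m B).
Proof.
move=> FA GB i j; under eq_fun do rewrite mxE.
have -> : (A *m G 0 + F 0 *m B) i j =
    \sum_k (A i k * G 0 k j + F 0 i k * B k j) by rewrite !mxE big_split.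
by apply: cderive_sum => k _; exact: cderiveM.
Qed.

Lemma mxderive_ct m n (F : R -> 'M[R[i]]_(m, n)) A :
  mxderive F A -> mxderive (fun t => (F t) ^t*) (A ^t*).
Proof.
move=> FA i j; rewrite !mxE; under eq_fun do rewrite !mxE.
exact: cderive_conj.
Qed.

Lemma cderive_trace n (F : R -> 'M[R[i]]_n) A :
  mxderive F A -> cderive (fun t => \tr (F t)) (\tr A).
Proof. by move=> FA; apply: cderive_sum => i _; exact: FA. Qed.

(** Existence is enough: the derivative of [\adj x *m X] is later identified by differentiating x
    times it. *)
Lemma mxderive_adj n (F : R -> 'M[R[i]]_n) A :
  mxderive F A -> exists B, mxderive (fun t => \adj (F t)) B.
Proof.
move=> FA.
have /choice[B FB] : forall p : 'I_n * 'I_n, exists b,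
    cderive (fun t => (\adj (F t)) p.1 p.2) b.
  move=> p; have [b Fb] := @cderive_det _ (fun t => row' p.2 (col' p.1 (F t)))
    (row' p.2 (col' p.1 A)) ltac:(move=> i j; rewrite !mxE;
      under eq_fun do rewrite !mxE; exact: FA).
  eexists; under eq_fun do rewrite mxE.
  exact: cderiveM (cderive_cst _) Fb.
by exists (\matrix_(i, j) B (i, j)) => i j; rewrite mxE; exact: (FB (i, j)).
Qed.

Lemma mxderive_linear n (S : 'M[R[i]]_n -> 'M[R[i]]_n) (F : R -> 'M[R[i]]_n) A :
  mx_linear S ->
  mxderive F A -> mxderive (fun t => S (F t)) (S A).
Proof.
move=> Sl FA a b; under eq_fun do rewrite (linear_mx_sum _ Sl) summxE.
rewrite (linear_mx_sum _ Sl) summxE.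
apply: cderive_sum => i _; under eq_fun do rewrite summxE; rewrite summxE.
apply: cderive_sum => j _; under eq_fun do rewrite mxE; rewrite mxE.
by apply: cderive_eq (cderiveM (FA i j) (cderive_cst _)) _; rewrite mulr0 addr0.
Qed.

Lemma differentiable_mxderive n (c : R -> rmat R n) :
  differentiable (c : R^o -> rmat R n) 0 ->
  mxderive (fun t => to_cmx (c t)) (to_cmx (derive1 c 0)).
Proof.
move=> cd i j; rewrite to_cmxE; split; under eq_fun do rewrite to_cmxE /=.
  exact: (is_derive_linear (@re_entry_continuous R n i j)).
exact: (is_derive_linear (@im_entry_continuous R n i j)).
Qed.

Lemma differentiable_sumfct (V W : normedModType R) (I : Type) (r : seq I)
    (f : I -> V -> W) x : (forall i, differentiable (f i) x) ->
  differentiable (fun y => \sum_(i <- r) f i y) x.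
Proof.
move=> fd; elim: r => [|i r IH].
  by under eq_fun do rewrite big_nil; exact: differentiable_cst.
by under eq_fun do rewrite big_cons; exact: differentiableD.
Qed.

Lemma mxderive_differentiable n (c : R -> rmat R n) A :
  mxderive (fun t => to_cmx (c t)) A -> differentiable (c : R^o -> rmat R n) 0.
Proof.
move=> cA; have -> : c = fun t => of_cmx (to_cmx (c t)).
  by apply/funext => t; rewrite to_cmxK.
under eq_fun do rewrite of_cmx_sum.
apply: differentiable_sumfct => p; have [[dr _] [di _]] := cA p.1 p.2.
by apply: differentiableD; apply: differentiableZl; exact/derivable1_diffP.
Qed.

Lemma mxderive_derive1 n (c : R -> rmat R n) A :
  mxderive (fun t => to_cmx (c t)) A -> derive1 c 0 = of_cmx A.
Proof.
move=> cA; apply: to_cmx_inj; rewrite of_cmxK; 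
exact: mxderive_unique (differentiable_mxderive (mxderive_differentiable cA)) cA.
Qed.
End DerivativeAtZero.

(** * Left-invariant endomorphism fields *)

Section LeftInvariant.
#[local] Opaque to_cmx of_cmx.
Context {R : realType} {n : nat}.
Implicit Types (x u v : rmat R n) (S : set (rmat R n)) (c : R -> rmat R n).

Lemma smooth_curve_mxderive S x c : smooth_curve S x c ->
  mxderive (fun t => to_cmx (c t)) (to_cmx (derive1 c 0)).
Proof.
move=> [_ [I [_ I0 Ic _]]]; apply: differentiable_mxderive.
by have [cd _] := Ic 1%N; exact: cd.
Qed.

Lemma smooth_curve_near S x c : smooth_curve S x c -> \forall t \near (0 : R), S (c t).
Proof.
move=> [_ [I [Io I0 _ IS]]]; have := open_nbhs_nbhs (conj Io I0).
by apply: filterS => t /IS.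
Qed.

Variables (G : set 'M[R[i]]_n) (g : 'M[R[i]]_n -> Prop).
Hypothesis G_det : forall A, G A -> \det A = 1.
Hypothesis tangentP : forall x v, realify G x ->
  tangent (realify G) x v <-> g (\adj (to_cmx x) *m to_cmx v).
Hypothesis g_trace : forall A, g A -> \tr A = 0.

Let mulV m x (A : 'M[R[i]]_(n, m)) : realify G x -> to_cmx x *m (\adj (to_cmx x) *m A) = A.
Proof. by move=> /G_det dx; rewrite mulmxA mul_mx_adj dx mul1mx. Qed.

Let Vmul m x (A : 'M[R[i]]_(n, m)) : realify G x -> \adj (to_cmx x) *m (to_cmx x *m A) = A.
Proof. by move=> /G_det dx; rewrite mulmxA mul_adj_mx dx mul1mx. Qed.

(** On determinant 1 the adjugate is the inverse. Being polynomial in x, it makes the formula smooth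
    on the whole ambient space, so that it is its own smooth extension. *)
Definition left_endo (A : 'M[R[i]]_n -> 'M[R[i]]_n) x v : rmat R n :=
  of_cmx (to_cmx x *m A (\adj (to_cmx x) *m to_cmx v)).

Lemma left_endoK A x v :
  to_cmx (left_endo A x v) = to_cmx x *m A (\adj (to_cmx x) *m to_cmx v).
Proof. exact: of_cmxK. Qed.

(** [derive_along] takes the value on some chosen curve; it is determined as soon as all curves with
    that velocity give the same value and one such curve exists. *)
Lemma derive_along_mx (f : rmat R n -> rmat R n) x v D : realify G x ->
  tangent (realify G) x v ->
  (forall c, smooth_curve (realify G) x c -> derive1 c 0 = v ->
     mxderive (fun t => to_cmx (f (c t))) D) ->
  derive_along (realify G) f x v = of_cmx D.
Proof.
move=> Sx [c cS cv] fD; rewrite /derive_along; case: xgetP => [w _ [c' [c'S c'v ->]]|].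
  exact/mxderive_derive1/fD.
move=> /(_ (of_cmx D)) []; exists c; split=> //.
exact/esym/mxderive_derive1/fD.
Qed.

#[local] Opaque derive_along.

(* For a field X = x * xi along the group, the derivative in the direction v
   is v * xi + x * xi' with xi' again traceless; xi' is the same for every
   left-invariant transform of X. *)
Lemma field_derive (X : rmat R n -> rmat R n) x v :
  vector_field (realify G) X -> realify G x -> tangent (realify G) x v ->
  let xi := \adj (to_cmx x) *m to_cmx (X x) in
  exists xi', [/\ \tr xi' = 0,
    derive_along (realify G) X x v = of_cmx (to_cmx v *m xi + to_cmx x *m xi')
  & forall A, mx_linear A ->
    derive_along (realify G) (app_endo (left_endo A) X) x v =
      of_cmx (to_cmx v *m A xi + to_cmx x *m A xi')].
Proof.
move=> [Xt Xs] Sx tv xi.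
have [U [F [Uo Ux Fs FX]]] := Xs _ Sx.
have [Fd _] := Fs 1%N.
pose D := to_cmx ('d F x v).
(* By the chain rule for the local extension F, the derivative of X along a curve depends only on
   the velocity. *)
have XD c : smooth_curve (realify G) x c -> derive1 c 0 = v ->
    mxderive (fun t => to_cmx (X (c t))) D.
  move=> cS cv; have [c0 [I [Io I0 Ic IS]]] := cS.
  have [cd _] := Ic 1%N; have cd0 := cd _ I0.
  have Fdc : differentiable F (c 0) by rewrite c0; exact: Fd.
  have Uc0 : U (c 0) by rewrite c0.
  have Fcd : differentiable (F \o (c : R^o -> rmat R n)) 0.
    exact: differentiable_comp cd0 Fdc.
  have := differentiable_mxderive Fcd.
  have -> : derive1 (F \o (c : R^o -> rmat R n)) 0 = 'd F x v.
    suff : derive1 (F \o (c : R^o -> rmat R n)) 0 = 'd F (c 0) (derive1 c 0).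
      by rewrite c0 cv.
    rewrite derive1E; apply: (etrans (deriveE (1 : R^o) Fcd)).
    rewrite (diff_comp cd0 Fdc) /=; congr ('d F _ _).
    by rewrite derive1E; apply/esym/deriveE.
  apply: mxderive_ext.
  have cU : \forall t \near (0 : R), U (c t).
    exact: (differentiable_continuous cd0 (open_nbhs_nbhs (conj Uo Uc0))).
  have cSn := smooth_curve_near cS.
  near=> t; rewrite /= FX //; [exact: (near cU t)|exact: (near cSn t)].
pose xi' := \adj (to_cmx x) *m (D - to_cmx v *m xi).
have xiD c : smooth_curve (realify G) x c -> derive1 c 0 = v ->
    mxderive (fun t => \adj (to_cmx (c t)) *m to_cmx (X (c t))) xi'.
  move=> cS cv; have [c0 _] := cS.
  have cD := smooth_curve_mxderive cS; rewrite cv in cD.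
  have [B aB] := mxderive_adj cD.
  have xiB := mxderiveM aB (XD _ cS cv); rewrite /= c0 in xiB.
  set E := _ + _ in xiB.
  have cE := mxderiveM cD xiB; rewrite /= c0 in cE.
  (* E is so far only known to exist. Differentiating X = x (adj x X) and comparing with D gives D =
     v xi + x E, hence E = xi'. *)
  have /(mxderive_unique (XD _ cS cv)) DE :
      mxderive (fun t => to_cmx (X (c t))) (to_cmx v *m xi + to_cmx x *m E).
    apply: mxderive_ext cE; apply: filterS (smooth_curve_near cS) => t ct.
    exact: mulV.
  apply: (eq_ind E (mxderive _) xiB).
  apply: (etrans (esym (Vmul E Sx))); rewrite /xi' DE; congr (_ *m _).
  by rewrite [X in X - _]addrC addrK.
have AD A c : mx_linear A ->
    smooth_curve (realify G) x c -> derive1 c 0 = v ->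
    mxderive (fun t => to_cmx (c t) *m A (\adj (to_cmx (c t)) *m to_cmx (X (c t))))
      (to_cmx v *m A xi + to_cmx x *m A xi').
  move=> Al cS cv; have [c0 _] := cS.
  have cD := smooth_curve_mxderive cS; rewrite cv in cD.
  by have := mxderiveM cD (mxderive_linear Al (xiD _ cS cv)); rewrite /= c0.
exists xi'; split.
(* The curve adj x X stays among the traceless matrices, so its derivative is traceless. *)
- have [c cS cv] := tv.
  have := cderive_trace (xiD _ cS cv) => /cderive_unique; apply.
  apply: (cderive_ext _ (cderive_cst 0)).
  apply: filterS (smooth_curve_near cS) => t ct.
  by apply/esym/g_trace/tangentP => //; exact: Xt.
- apply: derive_along_mx => // c cS cv.
  have := AD id c (fun _ _ _ => erefl) cS cv.
  by apply: mxderive_ext; apply: filterS (smooth_curve_near cS) => t ct; exact: mulV.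
- move=> A Al; apply: derive_along_mx => // c cS cv.
  by under eq_fun do rewrite left_endoK; exact: AD.
Unshelve. all: by end_near. Qed.

#[local] Opaque left_endo app_endo.

Variables (H : 'M[R[i]]_n) (eps : R) (A : 'M[R[i]]_n -> 'M[R[i]]_n).
Hypothesis AP : sl_structure H eps%:C%C A.
Hypothesis gA : forall Y, g Y -> g (A Y).

Lemma left_endo_adj x v : realify G x ->
  \adj (to_cmx x) *m to_cmx (left_endo A x v) = A (\adj (to_cmx x) *m to_cmx v).
Proof. by move=> Sx; rewrite left_endoK Vmul. Qed.

Lemma left_endo_tangent x v : realify G x -> tangent (realify G) x v ->
  tangent (realify G) x (left_endo A x v).
Proof.
move=> Sx /tangentP tv; apply/tangentP => //; rewrite left_endo_adj //.
by apply: gA; exact: tv.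
Qed.

Lemma left_endo_linear x a u v :
  left_endo A x (a *: u + v) = a *: left_endo A x u + left_endo A x v.
Proof.
apply: to_cmx_inj; apply: (etrans (left_endoK A x _)).
apply: (etrans (congr1 (fun Z => to_cmx x *m A (\adj (to_cmx x) *m Z)) (to_cmx_linear a u v))).
apply: (etrans _ (esym (to_cmx_linear _ _ _))).
apply: (etrans _ (esym (congr2 (fun Y Z => a%:C%C *: Y + Z)
  (left_endoK A x u) (left_endoK A x v)))).
by rewrite mulmxDr -scalemxAr (sls_linear AP) mulmxDr -scalemxAr.
Qed.

Lemma left_endo_smooth : smooth_endo (realify G) (left_endo A).
Proof.
split.
- exact: left_endo_tangent.
- by move=> x a u v _ _ _; exact: left_endo_linear.
- move=> p Sp; exists setT, (fun q => left_endo A q.1 q.2); split=> //; first exact: openT.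
  have fst_smooth : mxsmooth setT (fun q : rmat R n * rmat R n => to_cmx q.1).
    by apply: (@mxsmooth_to_cmx R n _ setT fst) => q; exact: cvg_fst.
  have snd_smooth : mxsmooth setT (fun q : rmat R n * rmat R n => to_cmx q.2).
    by apply: (@mxsmooth_to_cmx R n _ setT snd) => q; exact: cvg_snd.
  apply: (smooth_of_cmx openT).
  apply: (mxsmoothM openT fst_smooth).
  apply: (mxsmooth_linear openT (sls_linear AP)).
  exact: (mxsmoothM openT (mxsmooth_adj openT fst_smooth) snd_smooth).
Qed.

Lemma left_endo_square x v : realify G x -> tangent (realify G) x v ->
  left_endo A x (left_endo A x v) = eps *: v.
Proof.
move=> Sx /(tangentP _ Sx) tv; apply: to_cmx_inj; rewrite to_cmxZ left_endoK.
by rewrite left_endo_adj // (sls_square AP) ?g_trace // -scalemxAr mulV.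
Qed.

Lemma left_endo_field X : vector_field (realify G) X ->
  forall x, realify G x -> tangent (realify G) x (app_endo (left_endo A) X x).
Proof. by move=> [Xt _] x Sx; apply: left_endo_tangent => //; exact: Xt. Qed.

Lemma to_cmx_lie_bracket (X Y : rmat R n -> rmat R n) x B D :
  derive_along (realify G) Y x (X x) = of_cmx B ->
  derive_along (realify G) X x (Y x) = of_cmx D ->
  to_cmx (lie_bracket (realify G) X Y x) = B - D.
Proof. by move=> eB eD; rewrite /lie_bracket eB eD to_cmxB !of_cmxK. Qed.

(* With V = x xi and W = x eta, the first-order terms p and q cancel and only
   the Nijenhuis expression of A on the Lie algebra is left. *)
Lemma nijenhuis_cancel x b1 b2 b3 b4 (xi eta p1 p2 q1 q2 V W : 'M[R[i]]_n) :
  realify G x -> \tr xi = 0 -> \tr eta = 0 -> \tr p1 = 0 -> \tr q1 = 0 ->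
  to_cmx x *m xi = V -> to_cmx x *m eta = W ->
  to_cmx b1 = (to_cmx x *m A xi *m A eta + to_cmx x *m A p2)
            - (to_cmx x *m A eta *m A xi + to_cmx x *m A q2) ->
  to_cmx b2 = (V *m eta + to_cmx x *m p1) - (W *m xi + to_cmx x *m q1) ->
  to_cmx b3 = (to_cmx x *m A xi *m eta + to_cmx x *m p2)
            - (W *m A xi + to_cmx x *m A q1) ->
  to_cmx b4 = (V *m A eta + to_cmx x *m A p1)
            - (to_cmx x *m A eta *m xi + to_cmx x *m q2) ->
  b1 + eps *: b2 - left_endo A x b3 - left_endo A x b4 = 0.
Proof.
move=> Sx xi0 eta0 p0 q0 <- <- e1 e2 e3 e4; apply: to_cmx_inj.
have := left_endoK A x b3; have := left_endoK A x b4.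
move: (left_endo A x b3) (left_endo A x b4) => c3 c4 E4 E3.
rewrite to_cmx0 !to_cmxB to_cmxD to_cmxZ E3 E4 e1 e2 e3 e4.
rewrite -!mulmxA -!mulmxDr -!mulmxBr !Vmul //.
rewrite scalemxAr -mulmxDr -!mulmxBr.
have Al := sls_linear AP.
have AD Z Z' : A (Z + Z') = A Z + A Z' by rewrite -[Z in LHS]scale1r Al scale1r.
have A0 : A 0 = 0 by apply: (addrI (A 0)); rewrite -AD !addr0.
have AN Z : A (- Z) = - A Z.
  by apply: (addrI (A Z)); rewrite -AD !subrr A0.
have N0 := sls_nijenhuis AP xi0 eta0.
rewrite -[RHS](mulmx0 _ (to_cmx x)) -[in RHS]N0; congr (_ *m _).
rewrite /mxbr !AD !AN !AD !(sls_square AP) //.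
by mx_ring.
Qed.

Lemma left_endo_nijenhuis X Y x : vector_field (realify G) X ->
  vector_field (realify G) Y -> realify G x ->
  lie_bracket (realify G) (app_endo (left_endo A) X) (app_endo (left_endo A) Y) x
  + eps *: lie_bracket (realify G) X Y x
  - left_endo A x (lie_bracket (realify G) (app_endo (left_endo A) X) Y x)
  - left_endo A x (lie_bracket (realify G) X (app_endo (left_endo A) Y) x) = 0.
Proof.
move=> XF YF Sx.
have tX := XF.1 x Sx; have tY := YF.1 x Sx.
have tAX := left_endo_field XF Sx; have tAY := left_endo_field YF Sx.
(* The terms p1 and p2 come from Y along X and along its transform, q1 and q2 from X along Y and
   along its transform. Each serves both the field and its own transform. *)
have [p1 [p1t e1 a1]] := field_derive YF Sx tX.
have [p2 [_ e2 a2]] := field_derive YF Sx tAX.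
have [q1 [q1t e3 a3]] := field_derive XF Sx tY.
have [q2 [_ e4 a4]] := field_derive XF Sx tAY.
have Al := sls_linear AP.
have EX := left_endoK A x (X x); have EY := left_endoK A x (Y x).
apply: (nijenhuis_cancel Sx (g_trace ((tangentP _ Sx).1 tX))
  (g_trace ((tangentP _ Sx).1 tY)) p1t q1t (mulV _ Sx) (mulV _ Sx)).
- by apply: to_cmx_lie_bracket; [rewrite -EX; exact: a2|rewrite -EY; exact: a4].
- by apply: to_cmx_lie_bracket; [exact: e1|exact: e3].
- by apply: to_cmx_lie_bracket; [rewrite -EX; exact: e2|exact: a3].
- by apply: to_cmx_lie_bracket; [exact: a1|rewrite -EY; exact: e4].
Qed.
End LeftInvariant.

(** * Tangent spaces of SL and SU *)

Section CurvesInGroups.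
Context {R : realType} {n : nat}.
Implicit Types (A W X : 'M[R[i]]_n) (x v : rmat R n) (I : set R^o).

Lemma csmooth_cderive I (f : R -> R[i]) : I 0 -> csmooth (V := R^o) I f ->
  exists a, cderive f a.
Proof.
move=> I0 [fr fi]; have [dr _] := fr 1%N; have [di _] := fi 1%N.
exists ('D_1 (fun t : R^o => complex.Re (f t) : R^o) 0 +i*
        'D_1 (fun t : R^o => complex.Im (f t) : R^o) 0)%C.
by split; apply/derivableP/derivable1_diffP; [exact: dr|exact: di].
Qed.

Lemma mxsmooth_mxderive m p I (F : R -> 'M[R[i]]_(m, p)) : I 0 ->
  mxsmooth (V := R^o) I F -> exists B : 'M[R[i]]_(m, p), mxderive F B.
Proof.
move=> I0 Fs.
have /choice[A FA] : forall q : 'I_m * 'I_p, exists a, cderive (fun t => F t q.1 q.2) a.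
  by move=> q; exact: csmooth_cderive I0 (Fs _ _).
by exists (\matrix_(i, j) A (i, j)) => i j; rewrite mxE; exact: (FA (i, j)).
Qed.

Lemma csmooth_real I : csmooth (V := R^o) I (fun t => t%:C%C).
Proof.
split=> k /=; last exact: is_Ck_cst.
by apply: (is_Ck_linear k I (L := idfun)) => x; exact: cvg_id.
Qed.

Lemma mxsmooth_affine I (k : R[i]) (B W : 'M[R[i]]_n) : open I ->
  mxsmooth (V := R^o) I (fun t => B + (t%:C%C * k) *: W).
Proof.
move=> Io; apply: mxsmoothD => //; first exact: mxsmooth_cst.
apply: mxsmoothZ => //; last exact: mxsmooth_cst.
by apply: csmoothM => //; [exact: csmooth_real|exact: csmooth_cst].
Qed.

Lemma mxderive_affine (k : R[i]) (B W : 'M[R[i]]_n) :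
  mxderive (fun t => B + (t%:C%C * k) *: W) (k *: W).
Proof.
move=> i j; under eq_fun do rewrite !mxE.
have id1 : cderive (fun t : R => t%:C%C) 1 by split; [exact: is_derive_id|exact: is_derive_cst].
apply: cderive_eq.
  apply: cderiveD (cderive_cst _) _; apply: cderiveM (cderiveM id1 (cderive_cst k)) (cderive_cst _).
by rewrite /= !mulr0 !addr0 add0r mul1r mxE.
Qed.

Lemma open_neq0 (f : R -> R[i]) : csmooth (V := R^o) setT f ->
  open ([set t | f t != 0] : set R^o).
Proof.
move=> [fr fi].
pose q (t : R^o) : R^o := complex.Re (f t) * complex.Re (f t) + complex.Im (f t) * complex.Im (f t).
have -> : [set t | f t != 0] = q @^-1` [set y | y != 0].
  apply/seteqP; split=> t /=; rewrite /q; case: (f t) => a b /=;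
    rewrite eq_complex /= -!expr2 paddr_eq0 ?sqr_ge0 // !sqrf_eq0 //.
apply: open_comp; last exact: open_neq.
move=> t _; have qC : is_Ck 0 setT q.
  by apply: is_CkD (is_CkM _ (fr 0%N) (fr 0%N)) (is_CkM _ (fi 0%N) (fi 0%N)); exact: openT.
exact: qC.
Qed.

(** A matrix of prescribed determinant z, used to correct the determinant of a curve. If z is 1 with
    derivative 0 at t = 0, the correction leaves the velocity unchanged. *)
Definition scale_at (i0 : 'I_n) (z : R[i]) : 'M[R[i]]_n :=
  diag_mx (\row_i (if i == i0 then z else 1)).

Lemma det_scale_at i0 z : \det (scale_at i0 z) = z.
Proof.
rewrite det_diag (bigD1 i0) //= mxE eqxx big1 ?mulr1 // => i ii0.
by rewrite mxE (negbTE ii0).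
Qed.

Lemma scale_at1 i0 : scale_at i0 1 = 1%:M.
Proof.
rewrite -diag_const_mx; congr diag_mx.
by apply/rowP => i; rewrite !mxE if_same.
Qed.

Lemma mxsmooth_scale_at I i0 (f : R -> R[i]) : csmooth (V := R^o) I f ->
  mxsmooth (V := R^o) I (fun t => scale_at i0 (f t)).
Proof.
move=> fs i j; under eq_fun do rewrite !mxE.
case: (i == j); last by under eq_fun do rewrite mulr0n; exact: csmooth_cst.
under eq_fun do rewrite mulr1n.
by case: (i == i0) => //; exact: csmooth_cst.
Qed.

Lemma mxderive_scale_at i0 (f : R -> R[i]) : cderive f 0 ->
  mxderive (fun t => scale_at i0 (f t)) 0.
Proof.
move=> fs i j; rewrite mxE; under eq_fun do rewrite !mxE.
case: (i == j); last by under eq_fun do rewrite mulr0n; exact: cderive_cst.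
under eq_fun do rewrite mulr1n.
by case: (i == i0) => //; exact: cderive_cst.
Qed.

Lemma tangent_of_curve (G : set 'M[R[i]]_n) I (K : R -> 'M[R[i]]_n) W x v :
  (forall A B, G A -> G B -> G (A *m B)) -> realify G x ->
  open I -> I 0 -> mxsmooth (V := R^o) I K -> (forall t, I t -> G (K t)) ->
  K 0 = 1%:M -> mxderive K W -> to_cmx v = to_cmx x *m W ->
  tangent (realify G) x v.
Proof.
move=> GM Sx Io I0 Ks KG K0 KW vW.
have XK : mxderive (fun t => to_cmx (of_cmx (to_cmx x *m K t))) (to_cmx v).
  under eq_fun do rewrite of_cmxK.
  by have := mxderiveM (mxderive_cst (to_cmx x)) KW; rewrite mul0mx add0r vW.
exists (fun t => of_cmx (to_cmx x *m K t)); last first.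
  by rewrite (mxderive_derive1 XK) to_cmxK.
split; first by rewrite K0 mulmx1 to_cmxK.
exists I; split=> //.
  by apply: (smooth_of_cmx Io); apply: (mxsmoothM Io) Ks; exact: mxsmooth_cst.
by move=> t It; rewrite /realify /= of_cmxK; apply: GM => //; exact: KG.
Qed.

Lemma tangent_trace (G : set 'M[R[i]]_n) x v : (forall A, G A -> \det A = 1) ->
  realify G x -> tangent (realify G) x v -> \tr (\adj (to_cmx x) *m to_cmx v) = 0.
Proof.
move=> Gdet Sx [c cS cv]; have [c0 _] := cS.
have cD := smooth_curve_mxderive cS; rewrite cv in cD.
have := mxderiveM (mxderive_cst (\adj (to_cmx x))) cD; rewrite mul0mx add0r.
move=> /cderive_det1; rewrite c0 mul_adj_mx (Gdet _ Sx) => /(_ erefl)/cderive_unique; apply.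
apply: (cderive_ext _ (cderive_cst 1)).
apply: filterS (smooth_curve_near cS) => t ct.
rewrite det_mulmx (Gdet _ ct) mulr1.
have := congr1 determinant (mul_adj_mx (to_cmx x)).
by rewrite det_mulmx (Gdet _ Sx) mulr1 det1 => ->.
Qed.

Lemma tangent_skew (G : set 'M[R[i]]_n) (H : 'M[R[i]]_n) x v :
  (forall A, G A -> A ^t* *m H *m A = H) -> (forall A, G A -> \det A = 1) ->
  realify G x -> tangent (realify G) x v ->
  skew_hermitian H (\adj (to_cmx x) *m to_cmx v).
Proof.
move=> GH Gdet Sx [c cS cv]; have [c0 _] := cS.
have cD := smooth_curve_mxderive cS; rewrite cv in cD.
have FD := mxderiveM (mxderiveM (mxderive_ct cD) (mxderive_cst H)) cD.
have F0 : mxderive (fun t => (to_cmx (c t)) ^t* *m H *m to_cmx (c t)) 0.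
  apply: mxderive_ext (mxderive_cst H).
  by apply: filterS (smooth_curve_near cS) => t /GH.
have := mxderive_unique FD F0; rewrite mulmx0 addr0 c0.
set V := to_cmx v; set X := to_cmx x; set W := \adj X *m V.
have VE : V = X *m W by rewrite /W mulmxA mul_mx_adj (Gdet _ Sx) mul1mx.
have -> : V ^t* *m H *m X = W ^t* *m H.
  by rewrite VE ctmxM -!mulmxA (mulmxA _ H X) GH.
by rewrite VE mulmxA GH.
Qed.

Lemma mxderiveM1 (F E : R -> 'M[R[i]]_n) B :
  E 0 = 1%:M -> mxderive F B -> mxderive E 0 -> mxderive (fun t => F t *m E t) B.
Proof. by move=> E0 FB EE; have := mxderiveM FB EE; rewrite E0 mulmx1 mulmx0 addr0. Qed.

(** For the converse, det (1 + t W) is 1 to first order because tr W = 0; dividing one column by it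
    gives a curve in SL with velocity W. *)
Lemma SL_tangentP (i0 : 'I_n) x v : realify (SL_group R n) x ->
  tangent (realify (SL_group R n)) x v <-> \tr (\adj (to_cmx x) *m to_cmx v) = 0.
Proof.
move=> Sx; split; first exact: tangent_trace.
set W := _ *m _ => W0.
pose F (t : R) := 1%:M + (t%:C%C * 1) *: W.
have F0 : F 0 = 1%:M by rewrite /F mul0r scale0r addr0.
have FW : mxderive F W by rewrite -[X in mxderive _ X]scale1r; exact: mxderive_affine.
pose I : set R^o := [set t | \det (F t) != 0].
have Io : open I.
  by apply: open_neq0; apply: csmooth_det; [exact: openT|apply: mxsmooth_affine; exact: openT].
have I0 : I 0 by rewrite /I /= F0 det1 oner_neq0.
have Fs : mxsmooth (V := R^o) I F by exact: mxsmooth_affine.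
pose e t := (\det (F t))^-1.
have es : csmooth (V := R^o) I e by apply: csmoothV => //; exact: csmooth_det.
have e0 : e 0 = 1 by rewrite /e F0 det1 invr1.
have de0 : cderive e 0.
  have [b eb] := csmooth_cderive I0 es.
  have dF := cderive_det1 F0 FW; rewrite W0 in dF.
  have := cderiveM dF eb; rewrite mul0r add0r F0 det1 mul1r.
  move=> /cderive_unique/(_ _) b0; apply: cderive_eq eb (b0 _ _).
  apply: cderive_ext (cderive_cst 1).
  by apply: filterS (open_nbhs_nbhs (conj Io I0)) => t It; rewrite /e mulfV.
apply: (tangent_of_curve (I := I) (K := fun t => F t *m scale_at i0 (e t)) (W := W)) => //.
- by move=> A B A1 B1; rewrite /SL_group /= det_mulmx A1 B1 mulr1.
- by apply: mxsmoothM => //; exact: mxsmooth_scale_at.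
- by move=> t It; rewrite /SL_group /= det_mulmx det_scale_at mulfV.
- by rewrite F0 e0 scale_at1 mulmx1.
- apply: mxderiveM1 FW (mxderive_scale_at i0 de0).
  by rewrite e0 scale_at1.
- by rewrite /W mulmxA mul_mx_adj (_ : \det _ = 1) // mul1mx.
Qed.

Lemma ctmx_affine (t : R) (k : R[i]) W :
  (1%:M + (t%:C%C * k) *: W) ^t* = 1%:M + (t%:C%C * k^* ) *: W ^t*.
Proof.
rewrite ctmxD ctmx1 ctmxZ rmorphM /=; congr (_ + (_ * _) *: _).
by apply: complex_eqP; rewrite ?Rec_conj ?Imc_conj //= oppr0.
Qed.

Lemma affine_comm (a b : R[i]) W :
  (1%:M + a *: W) *m (1%:M + b *: W) = (1%:M + b *: W) *m (1%:M + a *: W).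
Proof.
rewrite !mulmxDl !mulmxDr !mul1mx !mulmx1 -!scalemxAl -!scalemxAr !scalerA.
by rewrite addrACA [b * a]mulrC.
Qed.

Lemma isometryM (H A B : 'M[R[i]]_n) :
  A ^t* *m H *m A = H -> B ^t* *m H *m B = H ->
  (A *m B) ^t* *m H *m (A *m B) = H.
Proof.
move=> AH BH; have -> : (A *m B) ^t* *m H *m (A *m B) = B ^t* *m (A ^t* *m H *m A) *m B.
  by rewrite ctmxM !mulmxA.
by rewrite AH.
Qed.

(** Here Z = M' M^-1. Multiplied by M on both sides, the claim compares M'^* H M' = H M M' with M^*
    H M = H M' M. *)
Lemma cayley_isometry (H M M' Z : 'M[R[i]]_n) : M \in unitmx -> Z *m M = M' ->
  M ^t* *m H = H *m M' -> M' ^t* *m H = H *m M -> M *m M' = M' *m M ->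
  Z ^t* *m H *m Z = H.
Proof.
move=> Mu ZM MH MH' MM; have Mcu : M ^t* \in unitmx by rewrite map_unitmx unitmx_tr.
suff : M ^t* *m (Z ^t* *m H *m Z) *m M = M ^t* *m H *m M.
  by move/(can_inj (mulmxK Mu))/(can_inj (mulKmx Mcu)).
have -> : M ^t* *m (Z ^t* *m H *m Z) *m M = (Z *m M) ^t* *m H *m (Z *m M).
  by rewrite ctmxM !mulmxA.
by rewrite ZM MH' MH -!mulmxA MM.
Qed.

Lemma det_isometry (H Z : 'M[R[i]]_n) : H \in unitmx -> Z ^t* *m H *m Z = H ->
  (\det Z)^* * \det Z = 1.
Proof.
rewrite unitmxE unitfE => H0 /(congr1 determinant).
rewrite !det_mulmx det_map_mx det_tr mulrAC => E.
by apply: (mulIf H0); rewrite mul1r.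
Qed.

(** In a basis that diagonalizes the form, multiplying one coordinate by a unit complex number is an
    isometry. *)
Lemma scale_at_isometry i0 (H Q : 'M[R[i]]_n) (d : 'rV[R[i]]_n) (z : R[i]) :
  H = Q ^t* *m diag_mx d *m Q -> Q \in unitmx -> z^* * z = 1 ->
  let E := invmx Q *m scale_at i0 z *m Q in E ^t* *m H *m E = H.
Proof.
move=> -> Qu z1; rewrite /= !ctmxM -!mulmxA (mulmxA Q (invmx Q)) mulmxV // mul1mx.
rewrite (mulmxA ((invmx Q) ^t* )) -ctmxM mulmxV // ctmx1 mul1mx; congr (_ *m _).
rewrite !mulmxA; congr (_ *m _).
rewrite /scale_at tr_diag_mx map_diag_mx !mulmx_diag; congr diag_mx.
apply/rowP => i; rewrite !mxE; case: (i == i0); last by rewrite rmorph1 mul1r mulr1.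
by rewrite mulrAC z1 mul1r.
Qed.

Lemma mxderive_conj (P Q B : 'M[R[i]]_n) (F : R -> 'M[R[i]]_n) :
  mxderive F B -> mxderive (fun t => P *m F t *m Q) (P *m B *m Q).
Proof.
move=> FB.
have := mxderiveM (mxderiveM (mxderive_cst P) FB) (mxderive_cst Q).
by rewrite mul0mx add0r mulmx0 addr0.
Qed.

(* The Cayley transform of a skew element is a curve of isometries; its
   determinant, a unit complex number, is then divided out. *)
Lemma SU_tangentP (i0 : 'I_n) (H Q : 'M[R[i]]_n) (d : 'rV[R[i]]_n) x v :
  H = Q ^t* *m diag_mx d *m Q -> Q \in unitmx -> H \in unitmx -> realify (SU_group H) x ->
  tangent (realify (SU_group H)) x v <->
  skew_hermitian H (\adj (to_cmx x) *m to_cmx v) /\ \tr (\adj (to_cmx x) *m to_cmx v) = 0.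
Proof.
move=> HE Qu Hu Sx; split.
  move=> tv; split; last by apply: tangent_trace tv => // A [].
  by apply: tangent_skew tv => // A [].
set W := _ *m _ => -[Wsk W0].
pose F (t : R) := 1%:M + (t%:C%C * - 2^-1) *: W.
pose F' (t : R) := 1%:M + (t%:C%C * 2^-1) *: W.
have F0 : F 0 = 1%:M by rewrite /F mul0r scale0r addr0.
have F0' : F' 0 = 1%:M by rewrite /F' mul0r scale0r addr0.
have FW : mxderive F (- 2^-1 *: W) by exact: mxderive_affine.
have FW' : mxderive F' (2^-1 *: W) by exact: mxderive_affine.
pose I : set R^o := [set t | \det (F t) != 0].
have Io : open I.
  by apply: open_neq0; apply: csmooth_det; [exact: openT|apply: mxsmooth_affine; exact: openT].
have I0 : I 0 by rewrite /I /= F0 det1 oner_neq0.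
(* The Cayley transform F' F^-1, with the inverse written through the adjugate so that smoothness on
   I is visible. The halves in F and F' add up to velocity W. *)
pose Z t := F' t *m ((\det (F t))^-1 *: \adj (F t)).
have ZF t : I t -> Z t *m F t = F' t.
  move=> It; rewrite /Z -mulmxA -scalemxAl mul_adj_mx scale_scalar_mx mulVf //.
  by rewrite mulmx1.
have Zs : mxsmooth (V := R^o) I Z.
  have Fs : mxsmooth (V := R^o) I F by exact: mxsmooth_affine.
  apply: (mxsmoothM Io); first exact: mxsmooth_affine.
  by apply: mxsmoothZ => //; [apply: csmoothV => //; exact: csmooth_det|exact: mxsmooth_adj].
have Z0 : Z 0 = 1%:M.
  by have := ZF 0 I0; rewrite F0 F0' mulmx1.
have ZW : mxderive Z W.
  have [B ZB] := mxsmooth_mxderive I0 Zs.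
  have FB : mxderive F' (B - 2^-1 *: W).
    apply: (@mxderive_ext _ _ _ (fun t => Z t *m F t)).
      by apply: filterS (open_nbhs_nbhs (conj Io I0)) => t; exact: ZF.
    by have := mxderiveM ZB FW; rewrite F0 Z0 mulmx1 mul1mx scaleNr.
  have <- : B = W; last exact: ZB.
  apply: (addIr (- (2^-1 *: W))); rewrite (mxderive_unique FB FW').
  by rewrite -[X in X - _]scale1r -scalerBl; congr (_ *: _); field.
have FH t : (F t) ^t* *m H = H *m F' t.
  rewrite ctmx_affine rmorphN fmorphV /= rmorph_nat mulmxDl mulmxDr mul1mx mulmx1.
  congr (_ + _); rewrite -scalemxAl -scalemxAr mulrN scaleNr -scalerN; congr (_ *: _).
  by move/eqP: Wsk; rewrite addr_eq0 => /eqP ->; rewrite opprK.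
have FH' t : (F' t) ^t* *m H = H *m F t.
  rewrite ctmx_affine fmorphV /= rmorph_nat mulmxDl mulmxDr mul1mx mulmx1.
  congr (_ + _); rewrite -scalemxAl -scalemxAr mulrN scaleNr -scalerN; congr (_ *: _).
  by move/eqP: Wsk; rewrite addr_eq0 => /eqP ->.
have comm t : F t *m F' t = F' t *m F t by exact: affine_comm.
have ZH t : I t -> (Z t) ^t* *m H *m Z t = H.
  move=> It; apply: (cayley_isometry _ (ZF t It) (FH t) (FH' t) (comm t)).
  by rewrite unitmxE unitfE.
pose u t := \det (Z t).
have u1 t : I t -> (u t)^* * u t = 1.
  by move=> /ZH; exact: det_isometry.
have u0 : u 0 = 1 by rewrite /u Z0 det1.
have us : csmooth (V := R^o) I u by exact: csmooth_det.
have du : cderive u 0 by have := cderive_det1 Z0 ZW; rewrite W0.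
(* Since u has modulus 1 on I, its conjugate is its inverse; it has derivative 0 because tr W =
   0. *)
pose e t := (u t)^*.
have e0 : e 0 = 1 by rewrite /e u0 rmorph1.
have es : csmooth (V := R^o) I e by exact: csmooth_conj.
have de : cderive e 0 by have := cderive_conj du; rewrite rmorph0.
pose E t := invmx Q *m scale_at i0 (e t) *m Q.
have Es : mxsmooth (V := R^o) I E.
  apply: (mxsmoothM Io); last exact: mxsmooth_cst.
  by apply: (mxsmoothM Io); [exact: mxsmooth_cst|exact: mxsmooth_scale_at].
have E0 : E 0 = 1%:M by rewrite /E e0 scale_at1 mulmx1 mulVmx.
have dE : mxderive E 0.
  have -> : 0 = invmx Q *m (0 : 'M[R[i]]_n) *m Q by rewrite mulmx0 mul0mx.
  exact: mxderive_conj (mxderive_scale_at i0 de).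
have EH t : I t -> (E t) ^t* *m H *m E t = H.
  move=> It; apply: (scale_at_isometry (z := e t) i0 HE Qu).
  by rewrite /e conjCK mulrC; exact: u1.
have detE t : \det (E t) = e t.
  by rewrite /E !det_mulmx det_scale_at mulrAC -det_mulmx mulVmx // det1 mul1r.
apply: (tangent_of_curve (K := fun t => Z t *m E t) (W := W) _ Sx Io I0).
- move=> A B [AH A1] [BH B1]; split; first exact: isometryM.
  by rewrite det_mulmx A1 B1 mulr1.
- exact: (mxsmoothM Io Zs Es).
- move=> t It; split; first exact: isometryM (ZH t It) (EH t It).
  by rewrite det_mulmx detE mulrC; exact: u1.
- by rewrite Z0 E0 mulmx1.
- exact: mxderiveM1 E0 ZW dE.
- by rewrite /W mulmxA mul_mx_adj (proj2 Sx : \det _ = 1) mul1mx.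
Qed.
End CurvesInGroups.

(** * Traces and the Killing form *)

Section TraceOn.
Context {F : fieldType} {vT : vectType F}.
Implicit Types (U : {vspace vT}) (f h : vT -> vT).

Lemma linear_fun_sum (wT : lmodType F) (f : vT -> wT) (I : Type) (r : seq I)
    (c : I -> F) (b : I -> vT) :
  (forall a u v, f (a *: u + v) = a *: f u + f v) ->
  f (\sum_(i <- r) c i *: b i) = \sum_(i <- r) c i *: f (b i).
Proof.
move=> fl; have f0 : f 0 = 0.
  by have := fl (-1) 0 0; rewrite scaler0 addr0 scaleN1r addNr.
elim: r => [|i r IH]; first by rewrite !big_nil.
by rewrite !big_cons fl IH.
Qed.

Lemma mem_vbasis_nth U (i : 'I_(\dim U)) : (vbasis U)`_i \in U.
Proof. by apply/vbasis_mem/mem_nth; rewrite size_tuple. Qed.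

Lemma eq_trace_on U f h : {in U, f =1 h} -> trace_on U f = trace_on U h.
Proof. by move=> fh; apply: eq_bigr => i _; rewrite fh // mem_vbasis_nth. Qed.

Lemma trace_onN U f : trace_on U (fun v => - f v) = - trace_on U f.
Proof. by rewrite /trace_on -sumrN; apply: eq_bigr => i _; rewrite linearN. Qed.

Lemma trace_on_comm U f h :
  (forall a u v, f (a *: u + v) = a *: f u + f v) ->
  (forall a u v, h (a *: u + v) = a *: h u + h v) ->
  {in U, forall v, f v \in U} -> {in U, forall v, h v \in U} ->
  trace_on U (f \o h) = trace_on U (h \o f).
Proof.
move=> fl hl fU hU.
have expand p q : (forall a u v, p (a *: u + v) = a *: p u + p v) ->
    {in U, forall v, q v \in U} -> trace_on U (p \o q) =
    \sum_(i < \dim U) \sum_(k < \dim U) coord (vbasis U) k (q (vbasis U)`_i) *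
      coord (vbasis U) i (p (vbasis U)`_k).
  move=> pl qU; apply: eq_bigr => i _ /=.
  rewrite {1}(coord_vbasis (qU _ (mem_vbasis_nth i))) linear_fun_sum // linear_sum.
  by apply: eq_bigr => k _; rewrite linearZ.
rewrite !expand // exchange_big; apply: eq_bigr => i _; apply: eq_bigr => k _.
exact: mulrC.
Qed.

(* tr P = - tr (P J J) = - tr (J P J) = - tr P. *)
Lemma trace_on_anticommuting U (P J : vT -> vT) : 2%:R != 0 :> F ->
  (forall a u v, P (a *: u + v) = a *: P u + P v) ->
  (forall a u v, J (a *: u + v) = a *: J u + J v) ->
  {in U, forall v, P v \in U} -> {in U, forall v, J v \in U} ->
  {in U, forall v, J (J v) = - v} -> {in U, forall v, P (J v) = - J (P v)} ->
  trace_on U P = 0.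
Proof.
move=> F2 Pl Jl PU JU JJ PJ.
have PN v : P (- v) = - P v.
  have P0 : P 0 = 0 by have := Pl (-1) 0 0; rewrite scaler0 addr0 scaleN1r addNr.
  by rewrite -scaleN1r -[_ *: v]addr0 Pl P0 addr0 scaleN1r.
have e1 : trace_on U ((P \o J) \o J) = - trace_on U P.
  by rewrite -trace_onN; apply: eq_trace_on => v vU /=; rewrite JJ // PN.
have e2 : trace_on U (J \o (P \o J)) = trace_on U P.
  apply: eq_trace_on => v vU /=; have JvU := JU v vU.
  by apply: oppr_inj; rewrite -PJ // JJ // PN.
have e3 : trace_on U ((P \o J) \o J) = trace_on U (J \o (P \o J)).
  by apply: trace_on_comm => // [a u v|v vU] /=; [rewrite Jl Pl|rewrite PU ?JU].
move/eqP: e3; rewrite e1 e2 eq_sym -addr_eq0 -mulr2n -mulr_natl mulf_eq0.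
by rewrite (negbTE F2) => /eqP.
Qed.
End TraceOn.

Lemma scaler_combination (K : comNzRingType) (V : lmodType K) (b c : K) (x y x' y' : V) :
  b *: (c *: x + y - (c *: x' + y')) = c *: (b *: (x - x')) + b *: (y - y').
Proof.
rewrite opprD addrACA -scalerBr scalerDr; congr (_ + _).
by rewrite !scalerA mulrC.
Qed.

(** * Real traces on matrices and the Killing forms of SL and SU *)

Section KillingForm.
Context {R : realType} {n : nat}.
Implicit Types (u v : rmat R n) (X Y : 'M[R[i]]_n).

(** The trace of a real-linear map in the real basis formed by the elementary matrices and their
    multiples by the imaginary unit. *)
Definition rtrace (f : rmat R n -> rmat R n) : R :=
  \sum_(p : 'I_n * 'I_n) ((f (delta_mx p.1 p.2, 0)).1 p.1 p.2
                        + (f (0, delta_mx p.1 p.2)).2 p.1 p.2).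

Lemma eq_rtrace f h : f =1 h -> rtrace f = rtrace h.
Proof. by move=> fh; apply: eq_bigr => p _; rewrite !fh. Qed.

Lemma rmat_sum u : u = \sum_(p : 'I_n * 'I_n)
  (u.1 p.1 p.2 *: ((delta_mx p.1 p.2, 0) : rmat R n) +
   u.2 p.1 p.2 *: ((0, delta_mx p.1 p.2) : rmat R n)).
Proof.
by rewrite -{1}(to_cmxK u) of_cmx_sum; apply: eq_bigr => p _; rewrite to_cmxE.
Qed.

Lemma rtrace_rank1 (l : {linear rmat R n -> R^o}) (b : rmat R n) :
  rtrace (fun x => l x *: b) = l b.
Proof.
rewrite [in RHS](rmat_sum b) linear_sum; apply: eq_bigr => p _.
by rewrite linearD !linearZ /= !mxE !(mulrC _ (_ p.1 p.2)).
Qed.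

(** The map f after pr has its image in U and equals f there, so both have the same trace. A
    projection thus takes the place of an explicit basis of U; the proof splits the map into
    rank-one pieces. *)
Lemma trace_on_proj (U : {vspace rmat R n}) (f pr : rmat R n -> rmat R n) :
  (forall a u v, f (a *: u + v) = a *: f u + f v) -> linear pr ->
  {in U, forall v, f v \in U} -> (forall v, pr v \in U) ->
  {in U, forall v, pr v = v} -> trace_on U f = rtrace (f \o pr).
Proof.
move=> fl prl fU prU prK.
pose prM := GRing.isLinear.Build _ _ _ _ _ prl.
pose prL : {linear rmat R n -> rmat R n} := HB.pack pr prM.
have -> : f \o pr = fun x => \sum_(i < \dim U)
    (coord (vbasis U) i \o prL) x *: f (vbasis U)`_i.
  by apply/funext => x /=; rewrite {1}(coord_vbasis (prU x)) linear_fun_sum.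
rewrite /rtrace; under eq_bigr do rewrite !raddf_sum !summxE -big_split /=.
rewrite exchange_big; apply: eq_bigr => i _.
have := rtrace_rank1 (coord (vbasis U) i \o prL : {linear rmat R n -> R^o}) (f (vbasis U)`_i).
rewrite /rtrace /= => ->.
by rewrite prK // fU // mem_vbasis_nth.
Qed.

Lemma of_cmx_linear (a : R) X Y : of_cmx (a%:C%C *: X + Y) = a *: of_cmx X + of_cmx Y.
Proof. by apply: to_cmx_inj; rewrite to_cmx_linear !of_cmxK. Qed.

Lemma mxbr_linear X (k : R[i]) Y Z : mxbr X (k *: Y + Z) = k *: mxbr X Y + mxbr X Z.
Proof.
rewrite /mxbr mulmxDl mulmxDr -scalemxAl -scalemxAr.
by rewrite scalerBr addrACA opprD.
Qed.

Lemma mxbr1 X : mxbr X 1%:M = 0.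
Proof. by rewrite /mxbr mulmx1 mul1mx subrr. Qed.

Lemma commutatorE u v : Defs.commutator u v = of_cmx (mxbr (to_cmx u) (to_cmx v)).
Proof. by []. Qed.

Lemma commutator_linear u a v w :
  Defs.commutator u (a *: v + w) = a *: Defs.commutator u v + Defs.commutator u w.
Proof.
apply: (etrans (congr1 (fun Z => of_cmx (mxbr (to_cmx u) Z)) (to_cmx_linear a v w))).
by rewrite mxbr_linear of_cmx_linear.
Qed.

Section LieAlgebra.
Variables (G : set 'M[R[i]]_n) (g : 'M[R[i]]_n -> Prop) (pr : 'M[R[i]]_n -> 'M[R[i]]_n).
Hypothesis tangent1 : forall v, tangent (realify G) (of_cmx 1%:M) v <-> g (to_cmx v).
Hypothesis pr_linear : forall (a : R) X Y, pr (a%:C%C *: X + Y) = a%:C%C *: pr X + pr Y.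
Hypothesis g_pr : forall X, g (pr X).
Hypothesis pr_id : forall X, g X -> pr X = X.
Hypothesis g_mxbr : forall X Y, g X -> g Y -> g (mxbr X Y).

Let rpr v : rmat R n := of_cmx (pr (to_cmx v)).

Let rpr_linear : linear rpr.
Proof. by move=> a u v; rewrite /rpr to_cmx_linear pr_linear of_cmx_linear. Qed.

(** The image of the projection is a subspace consisting of exactly the tangent vectors, which rules
    out the default value of [tangent_space]. *)
Lemma mem_lie_algebra v : v \in lie_algebra G <-> g (to_cmx v).
Proof.
rewrite /lie_algebra /tangent_space; case: xgetP => [U _ UP|noU].
  exact: iff_trans (UP v) (tangent1 v).
pose prM := GRing.isLinear.Build _ _ _ _ _ rpr_linear.
pose prL : {linear rmat R n -> rmat R n} := HB.pack rpr prM.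
exfalso; apply: (noU (limg (linfun prL))) => w.
apply: iff_trans _ (iff_sym (tangent1 w)); split.
  by move=> /memv_imgP[w' _ ->]; rewrite lfunE /= of_cmxK; exact: g_pr.
move=> gw; apply/memv_imgP; exists w; first exact: memvf.
by rewrite lfunE /= /rpr pr_id // to_cmxK.
Qed.

Lemma killing_form_rtrace u v : g (to_cmx u) -> g (to_cmx v) ->
  killing_form G u v =
  rtrace (fun w => of_cmx (mxbr (to_cmx u) (mxbr (to_cmx v) (pr (to_cmx w))))).
Proof.
move=> gu gv; rewrite /killing_form.
apply: (etrans (trace_on_proj _ rpr_linear _ _ _)).
- by move=> a w w'; rewrite commutator_linear commutator_linear.
- move=> w /mem_lie_algebra gw; apply/mem_lie_algebra.
  by rewrite !commutatorE !of_cmxK; apply: g_mxbr => //; exact: g_mxbr.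
- by move=> w; apply/mem_lie_algebra; rewrite of_cmxK; exact: g_pr.
- by move=> w /mem_lie_algebra gw; rewrite /rpr pr_id // to_cmxK.
apply: eq_rtrace => w.
apply: (congr1 (fun Z => of_cmx (mxbr (to_cmx u) Z))).
exact: (etrans (of_cmxK _) (congr1 (mxbr (to_cmx v)) (of_cmxK _))).
Qed.
End LieAlgebra.

Lemma to_cmx_delta_re (i j : 'I_n) : to_cmx (delta_mx i j, 0) = delta_mx i j :> 'M[R[i]]_n.
Proof.
by apply/matrixP => k l; rewrite to_cmxE !mxE; case: (_ && _).
Qed.

Lemma to_cmx_delta_im (i j : 'I_n) :
  to_cmx (0, delta_mx i j) = (0 +i* 1)%C *: delta_mx i j :> 'M[R[i]]_n.
Proof.
apply/matrixP => k l; rewrite to_cmxE !mxE; case: (_ && _); rewrite ?mulr1 ?mulr0 //.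
Qed.

(** The left side is the complex trace of Z |-> X Z Y. *)
Lemma mxtrace_sandwich X Y :
  \sum_(p : 'I_n * 'I_n) (X *m delta_mx p.1 p.2 *m Y) p.1 p.2 = \tr X * \tr Y.
Proof.
rewrite /mxtrace big_distrl /= -(pair_bigA _ (fun i j => (X *m delta_mx i j *m Y) i j)) /=.
apply: eq_bigr => i _; rewrite big_distrr; apply: eq_bigr => j _ /=.
rewrite -(mul_delta_mx (0 : 'I_1)) mulmxA -colE -mulmxA -rowE.
by rewrite mxE big_ord1 !mxE.
Qed.

(** Expanding ad X ad Y into four maps of the form Z |-> A Z B gives 2 n tr (X Y) - 2 tr X tr Y, the
    Killing form of gl(n). *)
Lemma mxtrace_ad X Y : \tr X = 0 ->
  \sum_(p : 'I_n * 'I_n) (mxbr X (mxbr Y (delta_mx p.1 p.2))) p.1 p.2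
  = \tr (X *m Y) *+ (2 * n).
Proof.
move=> X0.
have E (Z : 'M[R[i]]_n) : mxbr X (mxbr Y Z) =
    X *m Y *m Z *m 1%:M - X *m Z *m Y - (Y *m Z *m X - 1%:M *m Z *m (Y *m X)).
  by rewrite /mxbr !mulmxBr !mulmxBl !mulmx1 !mul1mx !mulmxA.
under eq_bigr do rewrite E !mx_entries.
rewrite !sumrB !mxtrace_sandwich X0 !mxtrace1 [\tr (Y *m X)]mxtrace_mulC.
by rewrite -[RHS]mulr_natl natrM; ring.
Qed.

Lemma Rec_muln (z : R[i]) k : complex.Re (z *+ k) = complex.Re z *+ k.
Proof. by elim: k => [|k IH]; rewrite ?mulr0n // !mulrSr Rec_add IH. Qed.

Lemma rtraceE (f : 'M[R[i]]_n -> 'M[R[i]]_n) :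
  rtrace (fun w => of_cmx (f (to_cmx w))) = \sum_(p : 'I_n * 'I_n)
    (complex.Re (f (delta_mx p.1 p.2) p.1 p.2) +
     complex.Im (f ((0 +i* 1)%C *: delta_mx p.1 p.2) p.1 p.2)).
Proof.
by apply: eq_bigr => p _; rewrite to_cmx_delta_re to_cmx_delta_im /of_cmx /= !mxE.
Qed.

Lemma mxbrZ X k Y : mxbr X (k *: Y) = k *: mxbr X Y.
Proof. by rewrite /mxbr -scalemxAl -scalemxAr scalerBr. Qed.

Lemma Imc_i (z : R[i]) : complex.Im ((0 +i* 1)%C * z) = complex.Re z.
Proof. by rewrite Imc_mul /= mul0r add0r mul1r. Qed.

Definition traceless X : 'M[R[i]]_n := X - (\tr X / n%:R) *: 1%:M.

Lemma traceless_linear k X Y : traceless (k *: X + Y) = k *: traceless X + traceless Y.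
Proof. by rewrite /traceless mxtraceD mxtraceZ; mx_ring. Qed.

Lemma mxtrace_traceless X : (0 < n)%N -> \tr (traceless X) = 0.
Proof.
by move=> n0; rewrite mxtraceB mxtraceZ mxtrace1 divfK ?subrr // pnatr_eq0 -lt0n.
Qed.

Lemma traceless_id X : \tr X = 0 -> traceless X = X.
Proof. by rewrite /traceless => ->; rewrite mul0r scale0r subr0. Qed.

Lemma mxbr_traceless X Y : mxbr X (traceless Y) = mxbr X Y.
Proof. by rewrite /traceless addrC -scaleNr mxbr_linear mxbr1 scaler0 add0r. Qed.

(** The real trace of a complex-linear map is twice the real part of its complex trace; the
    projection disappears because scalar matrices are central. *)
Lemma rtrace_SL X Y : \tr X = 0 ->
  rtrace (fun w => of_cmx (mxbr X (mxbr Y (traceless (to_cmx w)))))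
  = (2 * (2 * n))%:R * complex.Re (\tr (X *m Y)).
Proof.
move=> X0; rewrite (rtraceE (fun Z => mxbr X (mxbr Y (traceless Z)))).
under eq_bigr do rewrite !mxbr_traceless !mxbrZ scalemx_entry Imc_i -mulr2n.
rewrite sumrMnl -Rec_sum mxtrace_ad // Rec_muln.
by rewrite -mulrnA mulnC mulr_natl.
Qed.

(** The joint contribution of a basis matrix and its multiple by the imaginary unit: the
    complex-linear part A counts twice and the antilinear part B cancels. *)
Lemma Rec_half_sum (A B : 'M[R[i]]_n) i j :
  complex.Re (((2^-1)%:C%C *: (A - B)) i j) +
  complex.Im (((2^-1)%:C%C *: ((0 +i* 1)%C *: A - - ((0 +i* 1)%C *: B))) i j)
  = complex.Re (A i j).
Proof.
rewrite opprK -scalerDr !mx_entries; case: (A i j) (B i j) => a a' [b b'] /=.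
by field.
Qed.

Section SkewProjection.
Variable H : 'M[R[i]]_n.
Hypotheses (Hu : H \in unitmx) (H_ct : H ^t* = H).

(** The map Z |-> - H^-1 Z^* H is the antilinear involution that fixes exactly the skew matrices;
    averaging a traceless matrix with its image projects onto su(H). The projection is only
    real-linear. *)
Definition skew_part X : 'M[R[i]]_n :=
  (2^-1)%:C%C *: (traceless X - invmx H *m (traceless X) ^t* *m H).

Lemma conj_real (a : R) : (a%:C%C : R[i])^* = a%:C%C.
Proof. by apply: complex_eqP; rewrite ?Rec_conj ?Imc_conj //= oppr0. Qed.

Lemma skew_part_linear (a : R) X Y :
  skew_part (a%:C%C *: X + Y) = a%:C%C *: skew_part X + skew_part Y.
Proof.
rewrite /skew_part traceless_linear ctmxD ctmxZ conj_real mulmxDr mulmxDl.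
rewrite -[invmx H *m (_ *: _)]scalemxAr -[_ *: _ *m H]scalemxAl.
exact: scaler_combination.
Qed.

Lemma skew_part_skew X : skew_hermitian H (skew_part X).
Proof.
rewrite /skew_hermitian /skew_part ctmxZ conj_real ctmxD ctmxN !ctmxM trmxCK H_ct.
rewrite -scalemxAl -scalemxAr -scalerDr mulmxDl mulmxDr mulNmx mulmxN.
have HV : (invmx H) ^t* *m H = 1%:M by rewrite -{2}H_ct -ctmxM mulmxV // ctmx1.
rewrite -!mulmxA HV mulmx1 (mulmxA H) mulmxV // mul1mx.
by rewrite addrC addrA subrK subrr scaler0.
Qed.

Lemma mxtrace_skew_part X : (0 < n)%N -> \tr (skew_part X) = 0.
Proof.
move=> n0; rewrite mxtraceZ mxtraceB mxtrace_mulC mulmxA mulmxV // mul1mx.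
by rewrite mxtrace_ctmx mxtrace_traceless // rmorph0 subrr mulr0.
Qed.

Lemma skew_part_id X : \tr X = 0 -> skew_hermitian H X -> skew_part X = X.
Proof.
move=> X0 /eqP; rewrite addr_eq0 => /eqP Xsk.
rewrite /skew_part traceless_id // -mulmxA Xsk mulmxN mulmxA mulVmx // mul1mx opprK.
have half : 2^-1 + 2^-1 = 1 :> R by field.
by rewrite scalerDr -scalerDl -rmorphD half rmorph1 scale1r.
Qed.

(** The antilinear half of the projection has real trace zero, so the value is half of the one for
    SL. *)
Lemma rtrace_SU X Y : \tr X = 0 ->
  rtrace (fun w => of_cmx (mxbr X (mxbr Y (skew_part (to_cmx w)))))
  = (2 * n)%:R * complex.Re (\tr (X *m Y)).
Proof.
move=> X0; rewrite (rtraceE (fun Z => mxbr X (mxbr Y (skew_part Z)))).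
pose sg Z : 'M[R[i]]_n := invmx H *m Z ^t* *m H.
have sgE Z : mxbr X (mxbr Y (skew_part Z)) =
    (2^-1)%:C%C *: (mxbr X (mxbr Y Z) - mxbr X (mxbr Y (sg Z))).
  rewrite !mxbrZ; congr (_ *: _).
  have tl : sg (traceless Z) = traceless (sg Z).
    rewrite /sg /traceless ctmxD ctmxN ctmxZ ctmx1 mulmxDr mulmxDl mulmxN mulNmx.
    rewrite -[invmx H *m (_ *: _)]scalemxAr -[_ *: _ *m H]scalemxAl mulmx1 mulVmx //.
    congr (_ - _ *: _).
    rewrite mxtrace_mulC mulmxA mulmxV // mul1mx mxtrace_ctmx.
    by rewrite rmorphM fmorphV rmorph_nat.
  rewrite -/(sg (traceless Z)) tl addrC -scaleN1r !mxbr_linear !mxbr_traceless.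
  by rewrite scaleN1r addrC.
have sgZ Z : sg ((0 +i* 1)%C *: Z) = - ((0 +i* 1)%C *: sg Z).
  rewrite /sg ctmxZ -scalemxAr -scalemxAl -scaleNr; congr (_ *: _).
  by apply: complex_eqP; rewrite ?Rec_conj ?Imc_conj //= oppr0.
transitivity (\sum_(p : 'I_n * 'I_n) complex.Re (mxbr X (mxbr Y (delta_mx p.1 p.2)) p.1 p.2)).
  apply: eq_bigr => p _; move: (delta_mx p.1 p.2) => Z.
  have e2 : mxbr X (mxbr Y (skew_part ((0 +i* 1)%C *: Z))) = (2^-1)%:C%C *:
      ((0 +i* 1)%C *: mxbr X (mxbr Y Z) - - ((0 +i* 1)%C *: mxbr X (mxbr Y (sg Z)))).
    by apply: (etrans (sgE _)); rewrite sgZ -scaleNr !mxbrZ scaleNr.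
  apply: (etrans (congr2 (fun M N : 'M[R[i]]_n =>
    complex.Re (M p.1 p.2) + complex.Im (N p.1 p.2)) (sgE Z) e2)).
  exact: Rec_half_sum.
by rewrite -Rec_sum mxtrace_ad // Rec_muln mulr_natl.
Qed.
End SkewProjection.
End KillingForm.

(** * The invariant structures *)

Section InvariantCompatible.
Context {R : realType} {n : nat}.
Variables (G : set 'M[R[i]]_n) (g : 'M[R[i]]_n -> Prop) (kappa : R).
Hypothesis G_det : forall A, G A -> \det A = 1.
Hypothesis tangentP : forall x v, realify G x ->
  tangent (realify G) x v <-> g (\adj (to_cmx x) *m to_cmx v).
Hypothesis g_trace : forall A, g A -> \tr A = 0.
Hypothesis killing_trace : forall u v : rmat R n, g (to_cmx u) -> g (to_cmx v) ->
  killing_form G u v = kappa * complex.Re (\tr (to_cmx u *m to_cmx v)).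

Lemma left_endo_killing (H : 'M[R[i]]_n) (eps : R) A x u v :
  sl_structure H eps%:C%C A -> (forall Y, g Y -> g (A Y)) -> realify G x ->
  tangent (realify G) x u -> tangent (realify G) x v ->
  killing_metric G x (left_endo A x u) (left_endo A x v) = - eps * killing_metric G x u v.
Proof.
move=> AP gA Sx /(tangentP _ Sx) gu /(tangentP _ Sx) gv.
have VE (Y : 'M[R[i]]_n) : invmx (to_cmx x) *m Y = \adj (to_cmx x) *m Y.
  by rewrite /invmx unitmxE (G_det Sx) unitr1 invr1 scale1r.
have metricE w w' : g (\adj (to_cmx x) *m to_cmx w) -> g (\adj (to_cmx x) *m to_cmx w') ->
    killing_metric G x w w' = kappa *
      complex.Re (\tr (\adj (to_cmx x) *m to_cmx w *m (\adj (to_cmx x) *m to_cmx w'))).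
  by move=> gw gw'; rewrite /killing_metric !VE killing_trace of_cmxK ?of_cmxK.
have eu := left_endo_adj G_det A u Sx; have ev := left_endo_adj G_det A v Sx.
have gAu : g (\adj (to_cmx x) *m to_cmx (left_endo A x u)) by rewrite eu; exact: gA.
have gAv : g (\adj (to_cmx x) *m to_cmx (left_endo A x v)) by rewrite ev; exact: gA.
apply: (etrans (metricE _ _ gAu gAv)).
apply: (etrans (congr2 (fun Y Z => kappa * complex.Re (\tr (Y *m Z))) eu ev)).
apply: (etrans _ (esym (congr1 ( *%R (- eps)) (metricE u v gu gv)))).
rewrite (sls_form AP (g_trace gu) (g_trace gv)).
by case: (\tr _) => a b /=; ring.
Qed.

Lemma trace_on_tangent (H : 'M[R[i]]_n) (e e' : R) J P x :
  sl_structure H e%:C%C J -> sl_structure H e'%:C%C P ->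
  (forall Y, g Y -> g (J Y)) -> (forall Y, g Y -> g (P Y)) ->
  (forall v, tangent (realify G) x v ->
    left_endo P x (left_endo J x v) = - left_endo J x (left_endo P x v)) ->
  (forall v, tangent (realify G) x v -> left_endo J x (left_endo J x v) = - v) ->
  realify G x -> trace_on (tangent_space (realify G) x) (left_endo P x) = 0.
Proof.
move=> JP PP gJ gP anti JJ Sx; rewrite /tangent_space; case: xgetP => [U _ UP|_].
  apply: (trace_on_anticommuting (J := left_endo J x)).
  - by rewrite pnatr_eq0.
  - exact: left_endo_linear PP x.
  - exact: left_endo_linear JP x.
  - by move=> v /UP tv; apply/UP; exact: (left_endo_tangent G_det tangentP gP Sx tv).
  - by move=> v /UP tv; apply/UP; exact: (left_endo_tangent G_det tangentP gJ Sx tv).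
  - by move=> v /UP; exact: JJ.
  - by move=> v /UP; exact: anti.
(* If [tangent_space] takes its default value 0, the sum defining the trace is empty. *)
by apply: big1 => i; have := ltn_ord i; rewrite {2}dimv0.
Qed.

(** The stability condition offers preservation of the trace and of skewness together: SL draws on
    the first, SU on both. *)
Lemma left_invariant_cps (H : 'M[R[i]]_n) : sl_structure_pair H ->
  (forall A, (forall X, \tr X = 0 -> \tr (A X) = 0) ->
    (forall X, \tr X = 0 -> skew_hermitian H X -> skew_hermitian H (A X)) ->
    forall X, g X -> g (A X)) ->
  admits_killing_compatible_cps G.
Proof.
move=> [J] [P] [JP0 PP0 anti] stable.
have gJ := stable _ (sls_trace JP0) (sls_skew JP0).
have gP := stable _ (sls_trace PP0) (sls_skew PP0).
have JP : sl_structure H (- 1)%:C%C J by rewrite rmorphN rmorph1.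
have PP : sl_structure H 1%:C%C P by rewrite rmorph1.
have antiE x v : realify G x -> tangent (realify G) x v ->
    left_endo P x (left_endo J x v) = - left_endo J x (left_endo P x v).
  move=> Sx /(tangentP _ Sx)/g_trace tv; apply: to_cmx_inj.
  have eJ := left_endo_adj G_det J v Sx; have eP := left_endo_adj G_det P v Sx.
  have eL := etrans (left_endoK P x _) (congr1 (fun Y => to_cmx x *m P Y) eJ).
  have eR := etrans (left_endoK J x _) (congr1 (fun Y => to_cmx x *m J Y) eP).
  apply: (etrans eL); apply: (etrans _ (esym (etrans (to_cmxN _) (congr1 -%R eR)))).
  by rewrite anti // mulmxN.
have JJ x v : realify G x -> tangent (realify G) x v ->
    left_endo J x (left_endo J x v) = - v.
  by move=> Sx tv; rewrite (left_endo_square G_det tangentP g_trace JP) // scaleN1r.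
exists (left_endo P), (left_endo J); split; first split.
- split; first split.
  + exact: left_endo_smooth PP gP.
  + move=> x v Sx tv.
    by rewrite (left_endo_square G_det tangentP g_trace PP) // scale1r.
  + exists 0 => x Sx; apply: (trace_on_tangent JP PP gJ gP _ _ Sx) => v tv.
      exact: (antiE _ _ Sx tv).
    exact: (JJ _ _ Sx tv).
  + move=> X Y XF YF x Sx.
    have := left_endo_nijenhuis G_det tangentP g_trace PP gP XF YF Sx.
    by rewrite scale1r.
- split; first exact: left_endo_smooth JP gJ.
    exact: JJ.
  move=> X Y XF YF x Sx.
  have := left_endo_nijenhuis G_det tangentP g_trace JP gJ XF YF Sx.
  by rewrite scaleN1r.
- exact: antiE.
- move=> x u v Sx tu tv; split.
    by rewrite (left_endo_killing JP) // opprK mul1r.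
  by rewrite (left_endo_killing PP) // mulN1r.
Qed.
End InvariantCompatible.

(** * The groups SL and SU *)

Section Instances.
Context {R : realType}.

Lemma realify1 n (G : set 'M[R[i]]_n) : G 1%:M -> realify G (of_cmx 1%:M).
Proof. by rewrite /realify /= of_cmxK. Qed.

Lemma adj1 n : \adj (1%:M : 'M[R[i]]_n) = 1%:M.
Proof. by rewrite -[LHS]mulmx1 mul_adj_mx det1. Qed.

Lemma SL_admits_cps n (H : 'M[R[i]]_n) : (0 < n)%N -> sl_structure_pair H ->
  admits_killing_compatible_cps (SL_group R n).
Proof.
move=> n0 Hp.
have tP := @SL_tangentP R n (Ordinal n0).
have tangent1 (v : rmat R n) :
    tangent (realify (SL_group R n)) (of_cmx 1%:M) v <-> \tr (to_cmx v) = 0.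
  have := tP (of_cmx 1%:M) v (realify1 (det1 _ _)).
  by rewrite of_cmxK adj1 mul1mx.
apply: (left_invariant_cps (g := fun X => \tr X = 0) _ tP _ _ Hp) => //.
move=> u v u0 v0.
rewrite (@killing_form_rtrace R n _ (fun X => \tr X = 0) traceless tangent1) //.
- exact: rtrace_SL.
- by move=> a X Y; exact: traceless_linear.
- by move=> X; exact: mxtrace_traceless.
- by move=> X; exact: traceless_id.
- by move=> X Y _ _; exact: mxtrace_mxbr.
Qed.

Lemma skew_mxbr n (H X Y : 'M[R[i]]_n) :
  skew_hermitian H X -> skew_hermitian H Y -> skew_hermitian H (mxbr X Y).
Proof.
move=> /eqP; rewrite addr_eq0 => /eqP XH /eqP; rewrite addr_eq0 => /eqP YH.
rewrite /skew_hermitian /mxbr ctmxD ctmxN !ctmxM mulmxDl mulNmx mulmxBr.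
rewrite -!mulmxA XH YH !mulmxN !mulmxA XH YH !mulNmx !opprK.
by rewrite addrC subrKA subrr.
Qed.

Lemma SU_admits_cps n (H Q : 'M[R[i]]_n) (d : 'rV[R[i]]_n) : (0 < n)%N ->
  H = Q ^t* *m diag_mx d *m Q -> Q \in unitmx -> H \in unitmx -> H ^t* = H ->
  sl_structure_pair H -> admits_killing_compatible_cps (SU_group H).
Proof.
move=> n0 HE Qu Hu Hct Hp.
have tP (x v : rmat R n) : realify (SU_group H) x -> _ :=
  @SU_tangentP R n (Ordinal n0) H Q d x v HE Qu Hu.
have SU1 : SU_group H 1%:M by split; [rewrite ctmx1 mulmx1 mul1mx|exact: det1].
have tangent1 (v : rmat R n) :
    tangent (realify (SU_group H)) (of_cmx 1%:M) v <->
    skew_hermitian H (to_cmx v) /\ \tr (to_cmx v) = 0.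
  by have := tP (of_cmx 1%:M) v (realify1 SU1); rewrite of_cmxK adj1 mul1mx.
apply: (left_invariant_cps (g := fun X => skew_hermitian H X /\ \tr X = 0) _ tP _ _ Hp).
- by move=> A [].
- by move=> A [].
- move=> u v gu gv.
  rewrite (@killing_form_rtrace R n _
    (fun X => skew_hermitian H X /\ \tr X = 0) (skew_part H) tangent1) //.
  + exact: rtrace_SU gu.2.
  + by move=> a X Y; exact: skew_part_linear.
  + by move=> X; split; [exact: skew_part_skew|exact: mxtrace_skew_part].
  + by move=> X [Xs X0]; exact: skew_part_id.
  + by move=> X Y [Xs _] [Ys _]; split; [exact: skew_mxbr|exact: mxtrace_mxbr].
- by move=> A At As X [Xs X0]; split; [exact: As|exact: At].
Qed.
End Instances.

Theorem theorem1p4 (R : realType) (m : nat) (hm : (1 < m)%N) :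
  (forall H : 'M[R[i]]_(m + m.-1), hermitian_signature H ->
     admits_killing_compatible_cps (SU_group H)) /\
  admits_killing_compatible_cps (SL_group R (2 * m - 1)).
Proof.
(* From here m stands for the original m minus 1, so that the size [m + m.-1] becomes [m.+1 + m]. *)
case: m hm => [//|m] _; split.
  move=> H [Q Qu HE]; have Hp := pair_signature Qu; rewrite -HE in Hp.
  have DE : block_mx 1%:M 0 0 (- 1%:M) =
      diag_mx (row_mx (const_mx 1) (const_mx (- 1))) :> 'M[R[i]]_(m.+1 + m).
    by rewrite diag_mx_row !diag_const_mx rmorphN.
  have Qcu : Q ^t* \in unitmx by rewrite map_unitmx unitmx_tr.
  apply: (@SU_admits_cps R _ H Q (row_mx (const_mx 1) (const_mx (- 1)))) => //.
  - by rewrite -DE.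
  - rewrite HE !unitmx_mul Qu Qcu andbT /= unitmxE det_lblock det1 mul1r.
    by rewrite -scaleN1r detZ det1 mulr1 unitrX // unitrN unitr1.
  - rewrite HE !ctmxM trmxCK mulmxA ctmx_block ctmxN !ctmx1.
    by rewrite !trmx0 !map_mx0.
have -> : (2 * m.+1 - 1 = m.+1 + m)%N by rewrite mul2n -addnn addnS subn1.
apply: SL_admits_cps => //.
(* SL involves no form; the pair for the standard form, with Q = 1, supplies the operators. *)
exact: (pair_signature (unitmx1 _ _)).
Qed.
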